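(* Let $n\ge 2$, let $K_1,\dots,K_n$ be isomorphic simplicial complexes on a common vertex set $[m]=\{1,\dots,m\}$, and for $1\le i<j\le n$ let $\phi_{i,j}:K_i\to K_j$ be a simplicial isomorphism. Let $L_1,L_2$ be isomorphic subcomplexes of $K_1$ and assume that there is a simplicial automorphism $\psi:K_1\to K_1$ with $\psi(L_1)=L_2$ and $\psi(L_2)=L_1$. Let $M_n$ be the simplicial complex obtained from these data by the iterated gluing construction described in the context. Let $X$ be a path-connected pointed CW-complex, and let $G$ be the homotopy fibre of the inclusion $(X,* )^{L_2}\hookrightarrow (X,* )^{K_1}$. Then there is a homotopy equivalence \[\Omega (X,* )^{M_n}\simeq \Omega (X,* )^{K_1}\times \Omega F,\qquad\text{where } F\simeq\bigvee_{i=1}^{n-1}\Sigma G.\]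
   Context: Polyhedral products: let $K$ be a simplicial complex on the vertex set $[m]$ and $(X,A)$ a pair of pointed CW-complexes with $A$ a pointed subcomplex. For $\sigma\in K$ let $(X,A)^\sigma=\prod_{i=1}^m Y_i$, with $Y_i=X$ if $i\in\sigma$ and $Y_i=A$ if $i\notin\sigma$. Then $(X,A)^K=\bigcup_{\sigma\in K}(X,A)^\sigma\subseteq\prod_{i=1}^m X$. Here $A=*$ is the basepoint. Construction of $M_n$: $M_2$ is the pushout of $K_1\hookleftarrow L_2\xrightarrow{f_2}K_2$, where $f_2$ is the composite \[L_2\xrightarrow{\psi|_{L_2}}L_1\xrightarrow{\phi_{1,2}|_{L_1}}\phi_{1,2}(L_1)\hookrightarrow K_2.\] Inductively, for $n\ge3$, $M_n$ is the pushout of $M_{n-1}\hookleftarrow\phi_{1,n-1}(L_2)\xrightarrow{f_n}K_n$, where $\phi_{1,n-1}(L_2)\subseteq K_{n-1}$ is included in $M_{n-1}$ via the copy of $K_{n-1}$ contained in $M_{n-1}$, and $f_n$ is the composite \[\phi_{1,n-1}(L_2)\xrightarrow{\phi_{1,n-1}^{-1}}L_2\xrightarrow{\psi|_{L_2}}L_1\xrightarrow{\phi_{1,n}|_{L_1}}\phi_{1,n}(L_1)\hookrightarrow K_n.\] These pushouts are gluings: $M_n$ is a simplicial complex which is the union of subcomplexes $M_{n-1}$ and $K_n$ whose intersection is exactly the common copy of $\phi_{1,n-1}(L_2)$ (respectively, for $n=2$, $M_2$ is the union of $K_1$ and $K_2$ with intersection the common copy of $L_2$). $\Omega$ denotes the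 based loop space and $\Sigma$ the suspension. *)

(* Defs.v *)
From HB Require Import structures.
From mathcomp Require Import all_boot all_order all_algebra all_fingroup.
From mathcomp Require Import generic_quotient.
From mathcomp Require Import boolp classical_sets functions cardinality reals.
From mathcomp Require Import topology homotopy.

Set Implicit Arguments.
Unset Strict Implicit.
Unset Printing Implicit Defensive.

Import Order.TTheory GRing.Theory Num.Theory.
Import numFieldTopology.Exports.

Local Open Scope classical_set_scope.
Local Open Scope ring_scope.

(* The empty face always belongs to a complex; singletons need not, so that a
   subcomplex with fewer vertices lives on the same ambient type V. *)
Record scomplex (V : finType) := SComplex {
  faces : {set {set V}};
  faces0 : finset.set0 \in faces;
  facesS : forall s t : {set V}, t \subset s -> s \in faces -> t \in faces
}.

Definition subcomplex (V : finType) (L K : scomplex V) : Prop :=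
  faces L \subset faces K.

Definition vertices (V : finType) (K : scomplex V) : {set V} :=
  [set v | [set v]%SET \in faces K]%SET.

Definition simplicial_iso (V : finType) (f : {perm V}) (K K' : scomplex V) :
    Prop :=
  forall s : {set V}, (f @: s \in faces K') = (s \in faces K).

Section operations.
Variables V W : finType.

Section image.
Variables (f : V -> W) (K : scomplex V).

Definition image_faces : {set {set W}} := [set f @: (s : {set V}) | s in faces K].

Fact image_faces0 : finset.set0 \in image_faces.
Proof. by apply/imsetP; exists finset.set0; rewrite ?imset0 ?faces0. Qed.

Fact image_facesS (s t : {set W}) :
  t \subset s -> s \in image_faces -> t \in image_faces.
Proof.
move=> ts /imsetP[u uK es]; apply/imsetP; exists (u :&: f @^-1: t)%SET.
  by apply: facesS uK; apply: finset.subsetIl.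
apply/setP => y; apply/idP/imsetP => [yt | [x + ->]]; last first.
  by rewrite !inE => /andP[].
have /imsetP[x xu ey] : y \in f @: u by rewrite -es (fintype.subsetP ts).
by exists x; rewrite // !inE xu -ey.
Qed.

Definition image_complex := SComplex image_faces0 image_facesS.
End image.

Section union.
Variables K L : scomplex V.

Fact union_faces0 : finset.set0 \in (faces K :|: faces L)%SET.
Proof. by rewrite inE faces0. Qed.

Fact union_facesS (s t : {set V}) : t \subset s ->
  s \in (faces K :|: faces L)%SET -> t \in (faces K :|: faces L)%SET.
Proof.
by move=> ts; rewrite !inE => /orP[] /(facesS ts) ->; rewrite ?orbT.
Qed.

Definition union_complex := SComplex union_faces0 union_facesS.
End union.
End operations.

(* Pushout of M <-a- L -b-> N.  Its vertices are the elements of V + W modulo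
   a u ~ b u for u a vertex of L, each class being represented by its canonical
   root; its faces are the images of those of M and of N. *)

Section pushout.
Variables (U V W : finType) (L : scomplex U) (a : U -> V) (b : U -> W).

Definition glue_edge (x y : V + W) : bool :=
  [exists u in vertices L,
    ((x == inl (a u)) && (y == inr (b u)))
    || ((x == inr (b u)) && (y == inl (a u)))].

Fact glue_edge_sym : connect_sym glue_edge.
Proof.
apply: sym_connect_sym => x y.
by apply/exists_inP/exists_inP => -[u uL /orP[]/andP[/eqP-> /eqP->]];
  exists u; rewrite // !eqxx ?orbT.
Qed.

Definition pushout_vertex : finType := {x : V + W | fingraph.roots glue_edge x}.

Definition pushout_class (x : V + W) : pushout_vertex :=
  exist _ (fingraph.root glue_edge x) (roots_root glue_edge_sym x).

Definition pushout_inl (v : V) : pushout_vertex := pushout_class (inl v).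
Definition pushout_inr (w : W) : pushout_vertex := pushout_class (inr w).

Definition pushout_complex (M : scomplex V) (N : scomplex W) :
    scomplex pushout_vertex :=
  union_complex (image_complex pushout_inl M) (image_complex pushout_inr N).

(* The copies of M and N in the pushout meet exactly in the copy of L; this
   fails when a face common to M and N has its vertices in L but is not in L. *)
Definition pushout_is_gluing (M : scomplex V) (N : scomplex W) : Prop :=
  (faces (image_complex pushout_inl M) :&: faces (image_complex pushout_inr N)
   = faces (image_complex (pushout_inl \o a) L))%SET.

End pushout.

(* M_k on its own vertex type; [stage_emb] is the inclusion of the copy of K_k,
   the last complex glued. *)
Record stage (m : nat) := Stage {
  stage_vertex : finType;
  stage_complex : scomplex stage_vertex;
  stage_emb : 'I_m -> stage_vertex
}.

Section gluing.
Variables (m : nat) (K : nat -> scomplex 'I_m).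
Variables (phi : nat -> nat -> {perm 'I_m}) (psi : {perm 'I_m}).
Variable L2 : scomplex 'I_m.

(* phi_{1,k}, where phi_{1,1} is the identity of K_1. *)
Definition phi1 (k : nat) : {perm 'I_m} := if k == 1%N then 1%g else phi 1%N k.

(* The copy phi_{1,k}(L_2) of L_2 in K_k, along which K_{k+1} is glued. *)
Definition glue_locus (k : nat) : scomplex 'I_m := image_complex (phi1 k) L2.

(* f_{k+1} = phi_{1,k+1} o psi o phi_{1,k}^{-1}, on vertices. *)
Definition glue_map (k : nat) (v : 'I_m) : 'I_m :=
  phi1 k.+1 (psi ((phi1 k)^-1%g v)).

Definition glue_step (k : nat) (S : stage m) : stage m :=
  Stage
    (pushout_complex (glue_locus k) (stage_emb S) (glue_map k)
       (stage_complex S) (K k.+1))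
    (pushout_inr (glue_locus k) (stage_emb S) (glue_map k)).

(* [iterated_gluing n] is M_n for n >= 2, and M_1 = K_1; the value at 0 is
   irrelevant. *)
Fixpoint iterated_gluing (n : nat) : stage m :=
  match n with
  | 0 => Stage (K 1%N) id
  | k.+1 =>
    if k == 0%N then Stage (K 1%N) id else glue_step k (iterated_gluing k)
  end.

Definition gluing_condition (n : nat) : Prop :=
  forall k : nat, (1 <= k < n)%N ->
    pushout_is_gluing (glue_locus k) (stage_emb (iterated_gluing k))
      (glue_map k) (stage_complex (iterated_gluing k)) (K k.+1).

End gluing.

(* Spaces are pointed by [point]; maps, homotopies and homotopy equivalences are
   pointed. *)

(* Makes A * B a ptopologicalType. *)
HB.instance Definition _ (A B : ptopologicalType) := Pointed.on (A * B)%type.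

Record pointed_map (A B : ptopologicalType) := PointedMap {
  pointed_fun :> A -> B;
  pointed_fun_continuous : continuous pointed_fun;
  pointed_fun_point : pointed_fun point = point
}.

Definition unit_interval (R : realType) : Type :=
  set_type [set t : R | 0 <= t <= 1].

Section unit_interval.
Variable R : realType.

HB.instance Definition _ := Topological.copy (unit_interval R)
  (set_type [set t : R | 0 <= t <= 1]).

Fact unit_interval0_proof : (0 : R) \in [set t : R | 0 <= t <= 1].
Proof. by rewrite inE /= lexx ler01. Qed.

Fact unit_interval1_proof : (1 : R) \in [set t : R | 0 <= t <= 1].
Proof. by rewrite inE /= lexx ler01. Qed.

Definition unit_interval0 : unit_interval R := exist _ 0 unit_interval0_proof.
Definition unit_interval1 : unit_interval R := exist _ 1 unit_interval1_proof.

Fact unit_interval01 : unit_interval0 != unit_interval1.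
Proof. by apply/eqP => /(congr1 val)/eqP; rewrite /= eq_sym oner_eq0. Qed.

HB.instance Definition _ :=
  @isBiPointed.Build (unit_interval R) unit_interval0 unit_interval1
    unit_interval01.
End unit_interval.

Definition path_connected (R : realType) (X : topologicalType) : Prop :=
  forall x y : X, inhabited {path (unit_interval R) from x to y}.

Definition pointed_homotopic (R : realType) (A B : ptopologicalType)
    (f g : A -> B) : Prop :=
  exists H : A * unit_interval R -> B,
    [/\ continuous H,
        (forall a, H (a, zero) = f a),
        (forall a, H (a, one) = g a)
      & (forall t, H (point, t) = point)].

Definition homotopy_equivalent (R : realType) (A B : ptopologicalType) : Prop :=
  exists (f : pointed_map A B) (g : pointed_map B A),
    pointed_homotopic R (g \o f) id /\ pointed_homotopic R (f \o g) id.

Definition loop_space (R : realType) (X : ptopologicalType) : Type :=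
  {path (unit_interval R) from (point : X) to (point : X)}.

HB.instance Definition _ (R : realType) (X : ptopologicalType) :=
  Topological.copy (loop_space R X)
    {path (unit_interval R) from (point : X) to (point : X)}.
HB.instance Definition _ (R : realType) (X : ptopologicalType) :=
  isPointed.Build (loop_space R X) (cst (point : X)).

Section homotopy_fibre.
Variables (R : realType) (A B : ptopologicalType) (f : pointed_map A B).

Definition homotopy_fibre_set : set (A * {compact-open, unit_interval R -> B}) :=
  [set p | [/\ continuous (p.2 : unit_interval R -> B),
               p.2 zero = point & p.2 one = f p.1]].

Definition homotopy_fibre : Type := set_type homotopy_fibre_set.

Fact homotopy_fibre_point_proof : (point, cst point) \in homotopy_fibre_set.
Proof.
by rewrite inE; split => //=; [exact: cst_continuous | rewrite pointed_fun_point].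
Qed.

HB.instance Definition _ :=
  Topological.copy homotopy_fibre (set_type homotopy_fibre_set).
Definition homotopy_fibre_point : homotopy_fibre :=
  exist (fun p => p \in homotopy_fibre_set) _ homotopy_fibre_point_proof.
HB.instance Definition _ := isPointed.Build homotopy_fibre homotopy_fibre_point.
End homotopy_fibre.

(* T / A *)
Section collapse.
Variables (T : topologicalType) (A : set T).

Definition collapse_eq (x y : T) : bool :=
  (x == y) || ((x \in A) && (y \in A)).

Fact collapse_eq_refl : reflexive collapse_eq.
Proof. by move=> x; rewrite /collapse_eq eqxx. Qed.

Fact collapse_eq_sym : symmetric collapse_eq.
Proof. by move=> x y; rewrite /collapse_eq eq_sym andbC. Qed.

Fact collapse_eq_trans : transitive collapse_eq.
Proof.
move=> y x z /predU1P[-> //|/andP[xA yA]] /predU1P[<-|/andP[_ zA]].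
  by rewrite /collapse_eq xA yA orbT.
by rewrite /collapse_eq xA zA orbT.
Qed.

Definition collapse_rel :=
  EquivRel collapse_eq collapse_eq_refl collapse_eq_sym collapse_eq_trans.

Definition collapse := {eq_quot collapse_rel}%qT.

HB.instance Definition _ :=
  Topological.copy collapse (quotient_topology collapse).
HB.instance Definition _ := Quotient.on collapse.
End collapse.

(* Reduced suspension: the segment over the base point is collapsed too. *)
Section suspension.
Variables (R : realType) (Y : ptopologicalType).

Definition suspension_base : set (Y * unit_interval R) :=
  [set p | [\/ p.1 = point, p.2 = zero | p.2 = one]].

Definition suspension : Type := collapse suspension_base.

HB.instance Definition _ := Topological.copy suspension (collapse suspension_base).
HB.instance Definition _ :=
  isPointed.Build suspension (\pi_(collapse suspension_base) (point, zero))%qT.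
End suspension.

(* Base point of the index type, required by [pwedge]; it does not affect the
   wedge point. *)
HB.instance Definition _ (k : nat) := isPointed.Build 'I_k.+1 ord0.

Section disks.
Variables (R : realType) (n : nat).
Definition norm2 (v : 'rV[R]_n) : R := \sum_(i < n) v ord0 i ^+ 2.
Definition disk : set 'rV[R]_n := [set v | norm2 v <= 1].
Definition open_disk : set 'rV[R]_n := [set v | norm2 v < 1].
Definition sphere : set 'rV[R]_n := [set v | norm2 v = 1].
End disks.
Arguments disk : clear implicits.
Arguments open_disk : clear implicits.
Arguments sphere : clear implicits.

(* Characteristic maps are total on R^n, but only their values on the closed
   Euclidean disk matter. *)
Record cw_structure (R : realType) (X : topologicalType) := CWStructure {
  cell : Type;
  cell_dim : cell -> nat;
  char_map : forall e : cell, 'rV[R]_(cell_dim e) -> X;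
  open_cell := fun e => @char_map e @` open_disk R (cell_dim e);
  closed_cell := fun e => @char_map e @` disk R (cell_dim e);
  char_map_continuous : forall e,
    {within disk R (cell_dim e), continuous (@char_map e)};
  (* char_map e is a homeomorphism from the open disk onto the open cell *)
  char_map_inj : forall e, set_inj (open_disk R (cell_dim e)) (@char_map e);
  char_map_open : forall e (U : set 'rV[R]_(cell_dim e)), open U ->
    exists2 O : set X, open O &
      @char_map e @` (U `&` open_disk R (cell_dim e)) = O `&` open_cell e;
  cells_partition : forall x : X, exists! e, open_cell e x;
  closure_finite : forall e, exists2 C : set cell, finite_set C &
    (forall c, C c -> (cell_dim c < cell_dim e)%N) /\
    @char_map e @` sphere R (cell_dim e) `<=` \bigcup_(c in C) open_cell c;
  weak_topology : forall A : set X,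
    (forall e, closed (A `&` closed_cell e)) -> closed A
}.

(* A CW complex whose base point is a 0-cell, i.e. a subcomplex. *)
Definition pointed_cw_complex (R : realType) (X : ptopologicalType) : Prop :=
  hausdorff_space X /\
  exists (S : cw_structure R X) (e : cell S),
    cell_dim e = 0%N /\ open_cell e point.

Definition polyhedral_product (X : topologicalType) (A : set X) (V : finType)
    (K : scomplex V) : set {ptws V -> X} :=
  \bigcup_(s in [set s : {set V} | s \in faces K])
    [set x : {ptws V -> X} | forall i : V, if i \in s then setT (x i) else A (x i)].

Section polyhedral_power.
Variables (X : ptopologicalType) (V : finType).

(* (X, * )^K *)
Definition polyhedral_power (K : scomplex V) : Type :=
  set_type (polyhedral_product [set (point : X)] K).

Fact polyhedral_power_point_proof (K : scomplex V) :
  (fun=> point) \in polyhedral_product [set (point : X)] K.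
Proof.
rewrite inE; exists finset.set0; first exact: faces0.
by move=> i; rewrite finset.inE.
Qed.

HB.instance Definition _ (K : scomplex V) :=
  Topological.copy (polyhedral_power K)
    (set_type (polyhedral_product [set (point : X)] K)).
Definition polyhedral_power_point (K : scomplex V) : polyhedral_power K :=
  exist (fun x => x \in polyhedral_product [set (point : X)] K) _
    (polyhedral_power_point_proof K).
HB.instance Definition _ (K : scomplex V) :=
  isPointed.Build (polyhedral_power K) (polyhedral_power_point K).

Section inclusion.
Variables (L K : scomplex V) (LK : subcomplex L K).

Fact polyhedral_product_sub :
  polyhedral_product [set (point : X)] L `<=` polyhedral_product [set point] K.
Proof. by move=> x [s sL xs]; exists s => //; apply: (fintype.subsetP LK). Qed.

Definition polyhedral_incl_fun (x : polyhedral_power L) : polyhedral_power K :=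
  exist _ (val x) (mem_set (polyhedral_product_sub (set_mem (valP x)))).

Fact polyhedral_incl_continuous : continuous polyhedral_incl_fun.
Proof.
apply: continuous_comp_initial.
exact: initial_continuous.
Qed.

Fact polyhedral_incl_point : polyhedral_incl_fun point = point.
Proof. exact: val_inj. Qed.

Definition polyhedral_incl : pointed_map (polyhedral_power L) (polyhedral_power K) :=
  PointedMap polyhedral_incl_continuous polyhedral_incl_point.
End inclusion.
End polyhedral_power.

(* Main.v *)
Require Import Defs.
From mathcomp Require Import all_boot all_order all_algebra all_fingroup.
From mathcomp Require Import boolp classical_sets functions reals.
From mathcomp Require Import topology homotopy.
From mathcomp Require Import generic_quotient cardinality normedtype realfun.
From mathcomp Require Import ring lra.

(* Folding the n copies of K_1 in M_n onto one another retracts (X, * )^M_n onto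
   B = (X, * )^K_1; this makes sense for an arbitrary X because the folding is
   injective on each face of M_n.  Hence the loop space of (X, * )^M_n is the
   product of that of B and of that of the homotopy fibre F of the retraction.
   F is the union of n copies of the path space P of B, one for each copy of K_1;
   the copies k and k + 1, counted from 0, meet along the paths ending in
   (X, * )^(psi^-k L_2), i.e. along a copy of G.  As P is contractible and G has
   a halo in P, gluing one more copy of P adds a suspension of G.

   The halo comes from a deformation of a neighbourhood of the base point of X:
   it acts on tuples coordinatewise and on paths pointwise, so that it needs no
   homotopy lifting and commutes with the contraction of P. *)

Set Implicit Arguments.
Unset Strict Implicit.
Unset Printing Implicit Defensive.

Import Order.TTheory GRing.Theory Num.Theory.
Import numFieldTopology.Exports numFieldNormedType.Exports.

Local Open Scope classical_set_scope.
Local Open Scope ring_scope.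

(** * Continuity, loops and homotopy fibres *)

(** Each gluing map contains one [psi], so the fold of the next copy has to undo one more power of
    it in order to agree with the previous fold on the overlap; this is where the powers of [psi]
    come from. As [psi] is an automorphism of $K_1$, every pair $(K_1, \psi^{-k} L_2)$ is isomorphic
    to $(K_1, L_2)$, so all overlaps give the same $G$. A copy meets every earlier one inside its
    overlap with its immediate predecessor; hence only consecutive overlaps matter. The halo stands
    in for a cofibration. Its end map does not fix an overlap pointwise, it is only homotopic to the
    identity there, which costs one more homotopy in each direction of the equivalence. The union of
    the copies already treated need not be contractible, so the map to the wedge and the homotopies
    are built by recursion on the copies, the formula on a new copy starting, near the overlap, from
    that on the preceding one. Products with the interval of a quotient or of a CW complex are
    avoided: homotopies are built as maps into a compact-open function space and uncurried, the
    interval being locally compact. *)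

Section ContinuityCalculus.
Variables (R : realType) (T : topologicalType).
Implicit Types f g : T -> R.

Lemma cont_comp (U V : topologicalType) (g : U -> V) (f : T -> U) :
  continuous g -> continuous f -> continuous (fun z => g (f z)).
Proof. by move=> cg cf z; apply: continuous_comp; [exact: cf|exact: cg]. Qed.

Lemma cont_pair (U V : topologicalType) (f : T -> U) (g : T -> V) :
  continuous f -> continuous g -> continuous (fun z => (f z, g z)).
Proof. by move=> cf cg z; apply: cvg_pair; [exact: cf|exact: cg]. Qed.

Lemma cont_add f g :
  continuous f -> continuous g -> continuous (fun z => f z + g z).
Proof. by move=> cf cg z; apply: cvgD; [exact: cf|exact: cg]. Qed.

Lemma cont_opp f : continuous f -> continuous (fun z => - f z).
Proof. by move=> cf z; apply: cvgN; exact: cf. Qed.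

Lemma cont_mul f g :
  continuous f -> continuous g -> continuous (fun z => f z * g z).
Proof. by move=> cf cg z; apply: cvgM; [exact: cf|exact: cg]. Qed.

Lemma cont_max f g :
  continuous f -> continuous g -> continuous (fun z => Num.max (f z) (g z)).
Proof. by move=> cf cg z; apply: continuous_max; [exact: cf|exact: cg]. Qed.

Lemma cont_min f g :
  continuous f -> continuous g -> continuous (fun z => Num.min (f z) (g z)).
Proof. by move=> cf cg z; apply: continuous_min; [exact: cf|exact: cg]. Qed.

Lemma cont_norm f : continuous f -> continuous (fun z => `|f z|).
Proof.
by move=> cf z; apply: continuous_comp; [exact: cf|exact: norm_continuous].
Qed.

Lemma cont_cst (U : topologicalType) (c : U) : continuous (fun _ : T => c).
Proof. by move=> z; exact: cvg_cst. Qed.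

Lemma cont_id : continuous (fun z : T => z).
Proof. by move=> z; exact: cvg_id. Qed.

Lemma cont_fst (U V : topologicalType) (f : T -> U * V) :
  continuous f -> continuous (fun z => (f z).1).
Proof. by move=> cf z; apply: continuous_comp; [exact: cf|exact: cvg_fst]. Qed.

Lemma cont_snd (U V : topologicalType) (f : T -> U * V) :
  continuous f -> continuous (fun z => (f z).2).
Proof. by move=> cf z; apply: continuous_comp; [exact: cf|exact: cvg_snd]. Qed.

End ContinuityCalculus.

Lemma cont_fst0 (U V : topologicalType) : continuous (@fst U V).
Proof. by move=> z; exact: cvg_fst. Qed.

Lemma cont_snd0 (U V : topologicalType) : continuous (@snd U V).
Proof. by move=> z; exact: cvg_snd. Qed.


Lemma cont_pairl (U V : topologicalType) (a : U) : continuous (@pair U V a).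
Proof. exact: cont_pair (@cont_cst _ _ a) (@cont_id _). Qed.

(* [cont_hook] is redefined below, to register further continuous maps. *)
Ltac cont_hook := fail.
Ltac cont_step :=
  first
  [ assumption
  | lazymatch goal with
    | |- forall x, @continuous_at _ _ x (fun z => z) => apply: cont_id
    | |- forall x, @continuous_at _ _ x (fun _ => ?c) => apply: cont_cst
    | |- forall x, @continuous_at _ _ x (@fst _ _) => apply: cont_fst0
    | |- forall x, @continuous_at _ _ x (@snd _ _) => apply: cont_snd0
    | |- forall x, @continuous_at _ _ x (@pair _ _ _) => apply: cont_pairl
    | |- forall x, @continuous_at _ _ x (fun z => fst _) => apply: cont_fst
    | |- forall x, @continuous_at _ _ x (fun z => snd _) => apply: cont_snd
    | |- forall x, @continuous_at _ _ x (fun z => (_, _)) => apply: cont_pair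
    | |- forall x, @continuous_at _ _ x (fun z => (_ + _)%R) => apply: cont_add
    | |- forall x, @continuous_at _ _ x (fun z => (- _)%R) => apply: cont_opp
    | |- forall x, @continuous_at _ _ x (fun z => (_ * _)%R) => apply: cont_mul
    | |- forall x, @continuous_at _ _ x (fun z => Num.max _ _) => apply: cont_max
    | |- forall x, @continuous_at _ _ x (fun z => Num.min _ _) => apply: cont_min
    | |- forall x, @continuous_at _ _ x (fun z => `| _ |%R) => apply: cont_norm
    end
  | cont_hook ].
Ltac cont := repeat cont_step.

(** * Continuity on subspaces and pasting along closed sets *)

Section WithinCalculus.
Variables (R : realType) (T U : topologicalType).

Lemma within_comp (V : topologicalType) (A : set T) (B : set V)
    (f : T -> V) (g : V -> U) :
  {within B, continuous g} -> {within A, continuous f} ->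
  (forall x, A x -> B (f x)) -> {within A, continuous (fun x => g (f x))}.
Proof.
move=> /continuous_closedP cg /continuous_closedP cf AB.
apply/continuous_closedP => W cW.
have /closed_subspaceP[V1 cV1 V1W] := cg _ cW.
have /cf/closed_subspaceP[V2 cV2 V2W] := cV1.
apply/closed_subspaceP; exists V2 => //; rewrite V2W.
apply/seteqP; split => x [/= h Ax]; split => //.
  have : (V1 `&` B) (f x) by split => //; exact: AB.
  by rewrite V1W => -[].
have : (g @^-1` W `&` B) (f x) by split => //; exact: AB.
by rewrite -V1W => -[].
Qed.

Lemma within_continuous (A : set T) (f : T -> U) :
  continuous f -> {within A, continuous f}.
Proof. by move=> cf; apply: continuous_subspaceT. Qed.

Lemma eq_within (A : set T) (f g : T -> U) :
  (forall x, A x -> f x = g x) -> {within A, continuous f} ->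
  {within A, continuous g}.
Proof.
by move=> fg; apply: subspace_eq_continuous => x; rewrite inE => /fg.
Qed.

Lemma within_pair (V : topologicalType) (A : set T) (f : T -> U) (g : T -> V) :
  {within A, continuous f} -> {within A, continuous g} ->
  {within A, continuous (fun x => (f x, g x))}.
Proof. exact: (@cont_pair (subspace A)). Qed.

Lemma closed_ler (p q : T -> R) :
  continuous p -> continuous q -> closed [set z | p z <= q z].
Proof.
move=> cp cq.
have -> : [set z | p z <= q z] = (fun z => q z - p z) @^-1` [set x | 0 <= x].
  by apply/seteqP; split => z /=; rewrite subr_ge0.
by move: (@closed_ge R 0) => h; apply: (continuous_closedP _).1 h; cont.
Qed.

Lemma within_if (A : set T) (p q : T -> R) (f g : T -> U) :
  closed A -> continuous p -> continuous q ->
  {within A `&` [set z | p z <= q z], continuous f} ->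
  {within A `&` [set z | q z <= p z], continuous g} ->
  (forall z, A z -> p z = q z -> f z = g z) ->
  {within A, continuous (fun z => if p z <= q z then f z else g z)}.
Proof.
move=> cA cp cq cf cg fg.
have -> : A = (A `&` [set z | p z <= q z]) `|` (A `&` [set z | q z <= p z]).
  rewrite -setIUr; apply/seteqP; split => [z Az|z []//]; split => //=.
  by have [?|/ltW ?] := lerP (p z) (q z); [left|right].
apply: withinU_continuous.
- by apply: closedI => //; exact: closed_ler.
- by apply: closedI => //; exact: closed_ler.
- by apply: eq_within cf => z [_ /= ->].
- apply: eq_within cg => z [/= Az qp]; case: ifPn => // pq.
  by rewrite fg //; apply/eqP; rewrite eq_le pq qp.
Qed.

Lemma cont_within_if (p q : T -> R) (f g : T -> U) :
  continuous p -> continuous q ->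
  {within [set z | p z <= q z], continuous f} ->
  {within [set z | q z <= p z], continuous g} ->
  (forall z, p z = q z -> f z = g z) ->
  continuous (fun z => if p z <= q z then f z else g z).
Proof.
move=> cp cq cf cg fg; apply/continuous_subspace_setT.
by apply: within_if => //; [rewrite setTI|rewrite setTI|move=> z _; apply: fg].
Qed.

Lemma cont_if (p q : T -> R) (f g : T -> U) :
  continuous p -> continuous q -> continuous f -> continuous g ->
  (forall z, p z = q z -> f z = g z) ->
  continuous (fun z => if p z <= q z then f z else g z).
Proof.
move=> cp cq cf cg fg.
by apply: cont_within_if => //; exact: within_continuous.
Qed.

Lemma within_bigcup (I : choiceType) (D : set I) (A : I -> set T) (f : T -> U) :
  finite_set D -> (forall i, D i -> closed (A i)) ->
  (forall i, D i -> {within A i, continuous f}) ->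
  {within \bigcup_(i in D) A i, continuous f}.
Proof.
move=> fD cA cf; apply/continuous_closedP => W cW; apply/closed_subspaceP.
exists (\bigcup_(i in D) (A i `&` f @^-1` W)).
  apply: closed_bigcup => // i Di.
  have /continuous_closedP/(_ _ cW)/closed_subspaceP[V cV VW] := cf i Di.
  by rewrite setIC -VW; apply: closedI => //; exact: cA.
apply/seteqP; split => x.
  by case=> -[i Di [Aix Wfx]] _; split => //; exists i.
by case=> Wfx [i Di Aix]; split; exists i.
Qed.

Lemma cont_finite_cover (I : finType) (A : I -> set T) (f : T -> U) :
  (forall i, closed (A i)) -> (forall x, exists i, A i x) ->
  (forall i, {within A i, continuous f}) -> continuous f.
Proof.
move=> cA Acov cf; apply/continuous_subspace_setT.
have -> : setT = \bigcup_i A i.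
  by apply/seteqP; split => x // _; have [i Aix] := Acov x; exists i.
apply: within_bigcup => [|i _|i _]; [exact: finite_finset|exact: cA|exact: cf].
Qed.

End WithinCalculus.


(** * The unit interval and the exponential law *)

Section UnitInterval.
Variable R : realType.
Local Notation I := (unit_interval R).

Lemma regular_unit_interval : @regular_space I.
Proof. exact: (@uniform_regular (set_type [set t : R | 0 <= t <= 1])). Qed.

Lemma uival_continuous : continuous (val : I -> R).
Proof. exact: initial_continuous. Qed.

Lemma to_unit_interval_proof (x : R) :
  Num.min (Num.max x 0) 1 \in [set t : R | 0 <= t <= 1].
Proof. by rewrite inE /= le_min ler01 le_max lexx orbT ge_min lexx orbT. Qed.

(** Clamping lets paths and homotopies be evaluated at any real number, so that reparametrizations
    carry no proof of membership in the interval. *)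
Definition to_ui (x : R) : I :=
  exist (fun t => t \in [set t : R | 0 <= t <= 1]) _ (to_unit_interval_proof x).

Lemma to_ui_continuous : continuous to_ui.
Proof.
apply: continuous_comp_initial.
by rewrite -[_ \o _]/(fun x : R => Num.min (Num.max x 0) 1); cont.
Qed.

Lemma val_to_ui (x : R) : 0 <= x <= 1 -> val (to_ui x) = x.
Proof. by case/andP => x0 x1 /=; rewrite max_l // min_l. Qed.

Lemma ui_bounds (t : I) : 0 <= val t <= 1.
Proof. by have := valP t; rewrite inE. Qed.

Lemma uivalK (t : I) : to_ui (val t) = t.
Proof. by apply: val_inj; rewrite val_to_ui // ui_bounds. Qed.

Lemma to_ui_le0 (x : R) : x <= 0 -> to_ui x = zero.
Proof. by move=> x0; apply: val_inj; rewrite /= max_r // min_l. Qed.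

Lemma to_ui_ge1 (x : R) : 1 <= x -> to_ui x = one.
Proof.
by move=> x1; apply: val_inj; rewrite /= max_l ?min_r // (le_trans ler01).
Qed.

Lemma locally_compact_unit_interval : locally_compact [set: I].
Proof.
have cI : compact [set: I].
  have -> : [set: I] = to_ui @` `[0, 1].
    by apply/seteqP; split => t // _; exists (val t); rewrite ?uivalK //= in_itv /= ui_bounds.
  apply: continuous_compact; last exact: segment_compact.
  exact/within_continuous/to_ui_continuous.
move=> t _; exists [set: I]; first by rewrite withinET; exact: filterT.
by split => //; exact: closedT.
Qed.

End UnitInterval.

Section CompactOpen.
Variables (R : realType) (Z B : topologicalType).
Local Notation I := (unit_interval R).

Lemma cont_curry (f : Z * I -> B) : continuous f ->
  continuous ((fun z t => f (z, t)) : Z -> {compact-open, I -> B}).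
Proof. exact: continuous_curry_fun. Qed.

(** Evaluation is continuous since the interval is locally compact and regular; this is what allows
    homotopies to be built as maps into a function space. *)
Lemma cont_uncurry (f : Z -> {compact-open, I -> B}) : continuous f ->
  (forall z, continuous (f z : I -> B)) ->
  continuous (fun p : Z * I => f p.1 p.2).
Proof.
move=> cf cfz.
have := @continuous_uncurry_regular Z I B f (@locally_compact_unit_interval R)
  (@regular_unit_interval R) cf cfz.
rewrite (_ : uncurry f = fun p => f p.1 p.2) //.
by apply/funext => -[].
Qed.

End CompactOpen.

(** * Pointed homotopies with a real parameter *)

Section Homotopies.
Variables (R : realType) (A B : ptopologicalType).

Lemma pointed_homotopic_of (H : A * R -> B) (f g : A -> B) :
  continuous H -> (forall a, H (a, 0) = f a) -> (forall a, H (a, 1) = g a) ->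
  (forall t, 0 <= t <= 1 -> H (point, t) = point) -> pointed_homotopic R f g.
Proof.
move=> cH H0 H1 Hp; exists (fun p => H (p.1, val p.2)); split.
- apply: (cont_comp cH); cont.
  by apply: (cont_comp (@uival_continuous R)); cont.
- by move=> a; exact: H0.
- by move=> a; exact: H1.
- by move=> t; exact/Hp/ui_bounds.
Qed.

Lemma pointed_homotopic_fun (f g : A -> B) : pointed_homotopic R f g ->
  exists H : A * R -> B, [/\ continuous H, (forall a, H (a, 0) = f a),
    (forall a, H (a, 1) = g a) & (forall t, H (point, t) = point)].
Proof.
case=> H [cH H0 H1 Hp]; exists (fun p => H (p.1, to_ui p.2)); split.
- apply: (cont_comp cH); cont.
  by apply: (cont_comp (@to_ui_continuous R)); cont.
- by move=> a; rewrite to_ui_le0.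
- by move=> a; rewrite to_ui_ge1.
- by move=> t; exact: Hp.
Qed.

Lemma pointed_homotopic_trans (f g h : A -> B) :
  pointed_homotopic R f g -> pointed_homotopic R g h -> pointed_homotopic R f h.
Proof.
move=> /pointed_homotopic_fun[H [cH H0 H1 Hp]].
move=> /pointed_homotopic_fun[K [cK K0 K1 Kp]].
apply: (@pointed_homotopic_of (fun p =>
  if p.2 <= 2^-1 then H (p.1, 2 * p.2) else K (p.1, 2 * p.2 - 1))).
- apply: cont_if; cont.
  + by apply: (cont_comp cH); cont.
  + by apply: (cont_comp cK); cont.
  + move=> [a t] /= ->; rewrite (_ : 2 * 2^-1 = 1) ?H1; last lra.
    by rewrite subrr K0.
- by move=> a /=; rewrite ifT ?mulr0 ?H0 //; lra.
- move=> a /=; rewrite ifF; last by apply/negbTE; rewrite -ltNge; lra.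
  by rewrite (_ : 2 * 1 - 1 = 1) ?K1 //; lra.
- by move=> t _ /=; case: ifP.
Qed.

End Homotopies.

(** * Loops and points of homotopy fibres as functions of a real parameter *)

Section Loops.
Variables (R : realType) (X : ptopologicalType).
Local Notation I := (unit_interval R).
Local Notation OX := (loop_space R X).

Definition loop_at (l : OX) (t : R) : X := (l : I -> X) (to_ui t).

Lemma loop_at_le0 l t : t <= 0 -> loop_at l t = point.
Proof. by move=> t0; rewrite /loop_at to_ui_le0 // path_zero. Qed.

Lemma loop_at_ge1 l t : 1 <= t -> loop_at l t = point.
Proof. by move=> t1; rewrite /loop_at to_ui_ge1 // path_one. Qed.

Lemma loop_atP (l l' : OX) :
  (forall t, 0 <= t <= 1 -> loop_at l t = loop_at l' t) -> l = l'.
Proof.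
move=> ll'; apply/path_eqP => t.
by have := ll' (val t) (ui_bounds t); rewrite /loop_at uivalK.
Qed.

Lemma loop_at_continuous (T : topologicalType) (l : T -> OX) (t : T -> R) :
  continuous l -> continuous t -> continuous (fun z => loop_at (l z) (t z)).
Proof.
move=> cl ct.
have cl' : continuous (fun z => (l z : I -> X) : {compact-open, I -> X}).
  apply: (@cont_comp _ OX {compact-open, I -> X} (fun p => (p : I -> X))) => //.
  exact: initial_continuous.
have := cont_uncurry cl' (fun z => @cts_fun _ _ (l z)).
move=> h; apply: (cont_comp (f := fun z => (z, to_ui (t z))) h).
by cont; apply: (cont_comp (@to_ui_continuous R)).
Qed.

Section LoopMap.
Variables (T : topologicalType) (f : T * R -> X).
Hypotheses (cf : continuous f) (f0 : forall z, f (z, 0) = point)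
  (f1 : forall z, f (z, 1) = point).

Let fz_continuous z : continuous (fun t : I => f (z, val t)).
Proof.
apply: (cont_comp cf); cont.
exact: uival_continuous.
Qed.

Definition loop_map (z : T) : OX := mk_path (@fz_continuous z) (f0 z) (f1 z).

Lemma loop_map_at z t : 0 <= t <= 1 -> loop_at (loop_map z) t = f (z, t).
Proof. by move=> t01; rewrite /loop_at /= /mk_path val_to_ui. Qed.

Lemma loop_map_continuous : continuous loop_map.
Proof.
apply: continuous_comp_initial.
apply: (cont_curry (f := fun p : T * I => f (p.1, val p.2))).
apply: (cont_comp cf); cont.
by apply: (cont_comp (@uival_continuous R)); cont.
Qed.

End LoopMap.
End Loops.
Arguments loop_at : simpl never.
Arguments loop_map : simpl never.

Section HomotopyFibre.
Variables (R : realType) (A B : ptopologicalType) (f : pointed_map A B).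
Local Notation I := (unit_interval R).
Local Notation E := (homotopy_fibre R f).

Definition fibre_pt (z : E) : A := (val z).1.
Definition fibre_at (z : E) (t : R) : B := (val z).2 (to_ui t).

Lemma fibre_at_le0 z t : t <= 0 -> fibre_at z t = point.
Proof.
move=> t0; rewrite /fibre_at to_ui_le0 //.
by have := set_valP z => -[].
Qed.

Lemma fibre_at_ge1 z t : 1 <= t -> fibre_at z t = f (fibre_pt z).
Proof.
move=> t1; rewrite /fibre_at to_ui_ge1 //.
by have := set_valP z => -[].
Qed.

Lemma fibre_pt_point : fibre_pt point = point.
Proof. by []. Qed.

Lemma fibreP (z z' : E) : fibre_pt z = fibre_pt z' ->
  (forall t, 0 <= t <= 1 -> fibre_at z t = fibre_at z' t) -> z = z'.
Proof.
move=> zz' h; apply: val_inj; apply: injective_projections => //.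
apply/funext => t; have := h (val t) (ui_bounds t).
by rewrite /fibre_at uivalK.
Qed.

Lemma fibre_pt_continuous : continuous fibre_pt.
Proof. by apply: cont_fst; exact: initial_continuous. Qed.

Lemma fibre_at_continuous (T : topologicalType) (z : T -> E) (t : T -> R) :
  continuous z -> continuous t -> continuous (fun x => fibre_at (z x) (t x)).
Proof.
move=> cz ct.
have cz' : continuous (fun x => (val (z x)).2 : {compact-open, I -> B}).
  by apply: cont_snd; apply: cont_comp => //; exact: initial_continuous.
have cz2 x : continuous ((val (z x)).2 : I -> B).
  by have := set_valP (z x) => -[].
have h := cont_uncurry cz' cz2.
apply: (cont_comp (f := fun x => (x, to_ui (t x))) h).
by cont; apply: (cont_comp (@to_ui_continuous R)).
Qed.

Section FibreMap.
Variables (T : topologicalType) (a : T -> A) (h : T * R -> B).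
Hypotheses (ca : continuous a) (ch : continuous h)
  (h0 : forall z, h (z, 0) = point) (h1 : forall z, h (z, 1) = f (a z)).

Lemma fibre_map_proof z :
  (a z, fun t : I => h (z, val t)) \in homotopy_fibre_set (R := R) f.
Proof.
rewrite inE; split => /=; [|exact: h0|exact: h1].
by apply: (cont_comp ch); cont; exact: uival_continuous.
Qed.

Definition fibre_map (z : T) : E :=
  exist (fun p => p \in homotopy_fibre_set f) _ (fibre_map_proof z).

Lemma fibre_map_pt z : fibre_pt (fibre_map z) = a z.
Proof. by []. Qed.

Lemma fibre_map_at z t : 0 <= t <= 1 -> fibre_at (fibre_map z) t = h (z, t).
Proof. by move=> t01; rewrite -{2}(val_to_ui t01). Qed.

Lemma fibre_map_continuous : continuous fibre_map.
Proof.
apply: continuous_comp_initial; apply: cont_pair => //.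
apply: (cont_curry (f := fun p : T * I => h (p.1, val p.2))).
apply: (cont_comp ch); cont.
by apply: (cont_comp (@uival_continuous R)); cont.
Qed.

End FibreMap.
End HomotopyFibre.
Arguments fibre_pt : simpl never.
Arguments fibre_at : simpl never.
Arguments fibre_map : simpl never.

(** * Base points of CW complexes *)

Section Compactness.

Lemma cont_inv (R : realType) (T : topologicalType) (f : T -> R) :
  continuous f -> (forall z, f z != 0) -> continuous (fun z => (f z)^-1).
Proof. by move=> cf f0 z; apply: cvgV; [exact: f0|exact: cf]. Qed.

Lemma hausdorff_prod (T U : topologicalType) :
  hausdorff_space T -> hausdorff_space U -> hausdorff_space (T * U)%type.
Proof.
move=> hT hU [x y] [x' y'] /= h; congr (_, _).
  apply: hT => P Q Px Qx'.
  have [||[a b] [/= aP aQ]] := h (fst @^-1` P) (fst @^-1` Q).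
  - exact: (@cont_fst0 T U (x, y)).
  - exact: (@cont_fst0 T U (x', y')).
  - by exists a.
apply: hU => P Q Px Qx'.
have [||[a b] [/= aP aQ]] := h (snd @^-1` P) (snd @^-1` Q).
- exact: (@cont_snd0 T U (x, y)).
- exact: (@cont_snd0 T U (x', y')).
- by exists b.
Qed.

(* A continuous map from a compact space to a Hausdorff one is closed, hence a
   quotient map onto its image. *)
Lemma within_image_compact (T V U : topologicalType) (D : set T) (g : T -> V)
    (h : V -> U) : compact D -> hausdorff_space V ->
  {within D, continuous g} -> {within D, continuous (fun x => h (g x))} ->
  {within g @` D, continuous h}.
Proof.
move=> cD hV cg chg; apply/continuous_closedP => W cW.
apply/closed_subspaceP.
have /closed_subspaceP[Y cY YW] := (continuous_closedP _).1 chg W cW.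
exists (g @` (Y `&` D)).
  apply: compact_closed => //; apply: continuous_compact.
    by apply: continuous_subspaceW cg => x [].
  by rewrite setIC; apply: compact_closedI.
rewrite YW; apply/seteqP; split.
  by move=> _ [[x [/= Wx Dx] <-] [y Dy _]]; split => //; exists x.
move=> y [/= Wy [x Dx xy]]; split; last by exists x.
by exists x => //; split => //; rewrite -xy in Wy.
Qed.

Lemma closed_setX (T U : topologicalType) (A : set T) (B : set U) :
  closed A -> closed B -> closed (A `*` B).
Proof.
move=> cA cB; have -> : A `*` B = fst @^-1` A `&` snd @^-1` B by [].
apply: closedI.
  exact: (continuous_closedP _).1 (@cont_fst0 T U) _ cA.
exact: (continuous_closedP _).1 (@cont_snd0 T U) _ cB.
Qed.

End Compactness.

(** * Euclidean disks *)

Section EuclideanNorm.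
Variables (R : realType) (n : nat).
Implicit Types v : 'rV[R]_n.

Definition enorm v : R := Num.sqrt (norm2 v).

Lemma norm2_ge0 v : 0 <= norm2 v.
Proof. by apply: sumr_ge0 => i _; exact: sqr_ge0. Qed.

Lemma enormZ a v : 0 <= a -> enorm (a *: v) = a * enorm v.
Proof.
move=> a0; rewrite /enorm (_ : norm2 _ = a ^+ 2 * norm2 v).
  by rewrite sqrtrM ?sqr_ge0 // sqrtr_sqr ger0_norm.
by rewrite /norm2 mulr_sumr; apply: eq_bigr => i _; rewrite mxE exprMn.
Qed.

Lemma diskE v : disk R n v = (enorm v <= 1).
Proof.
by apply/propext; rewrite /disk /enorm /= -{2}sqrtr1 ler_sqrt ?ltr01.
Qed.

Lemma open_diskE v : open_disk R n v = (enorm v < 1).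
Proof. by rewrite /open_disk /enorm /= -{2}sqrtr1 ltr_sqrt ?ltr01. Qed.

Lemma sphereE v : sphere R n v <-> enorm v = 1.
Proof.
rewrite /sphere /enorm /=; split=> [->|h]; first exact: sqrtr1.
by rewrite -[norm2 v]sqr_sqrtr ?norm2_ge0 // h expr1n.
Qed.

Lemma norm2_continuous : continuous (@norm2 R n).
Proof.
rewrite /norm2; apply: continuous_big => [|i _]; first exact: add_continuous.
by apply: (cont_mul (f := fun v => v ord0 i)); exact: coord_continuous.
Qed.

Lemma enorm_continuous : continuous enorm.
Proof.
apply: (cont_comp (g := Num.sqrt) (f := @norm2 R n)) => //.
- exact: sqrt_continuous.
- exact: norm2_continuous.
Qed.

Lemma cont_scale (T : topologicalType) (a : T -> R) (f : T -> 'rV[R]_n) :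
  continuous a -> continuous f -> continuous (fun z => a z *: f z).
Proof. by move=> ca cf z; apply: cvgZ; [exact: ca|exact: cf]. Qed.

Lemma disk_closed : closed (disk R n).
Proof.
have := @closed_ler R _ (@norm2 R n) (fun=> 1) norm2_continuous.
by apply; cont.
Qed.

Lemma disk_compact : compact (disk R n).
Proof.
apply: subclosed_compact disk_closed
  (@rV_compact R n (fun=> `[(- 1 : R), 1]%classic) _) _.
  by move=> _; exact: segment_compact.
move=> v /= v1 i; rewrite in_itv /= -ler_norml.
rewrite -(@ler_pXn2r _ 2) ?nnegrE // expr1n real_normK ?num_real //.
apply: le_trans v1; rewrite /norm2 (bigD1 i) //= lerDl.
by apply: sumr_ge0 => j _; exact: sqr_ge0.
Qed.

End EuclideanNorm.

(** * Homotopy extension from the base point of a CW complex *)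

Section HomotopyExtension.
Variables (R : realType) (X : ptopologicalType) (S : cw_structure R X).
Hypothesis hX : hausdorff_space X.
Variable e0 : cell S.
Hypotheses (dim_e0 : cell_dim e0 = 0%N) (e0_point : open_cell e0 point).
Variables (Z : topologicalType) (f : X -> Z) (w : R -> Z).
Hypotheses (cf : continuous f) (cw : continuous w) (fw : f point = w 0).

Local Notation chi := (@char_map R X S _).

Definition cell_of (x : X) : cell S := projT1 (cid (cells_partition S x)).

Lemma cell_ofP x : open_cell (cell_of x) x.
Proof. by rewrite /cell_of; case: cid => e []. Qed.

Lemma cell_of_unique x e : open_cell e x -> cell_of x = e.
Proof. by rewrite /cell_of; case: cid => e' /= [_]; apply. Qed.

Definition cell_coord (x : X) : 'rV[R]_(cell_dim (cell_of x)) :=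
  s2val (cid2 (cell_ofP x)).

Lemma cell_coord_lt1 x : enorm (cell_coord x) < 1.
Proof.
by rewrite /cell_coord; case: cid2 => v /= + _; rewrite open_diskE.
Qed.

Lemma char_map_coord x : chi (cell_coord x) = x.
Proof. by rewrite /cell_coord; case: cid2. Qed.

(** The cell of [chi v] equals [e] only propositionally, so [cell_coord (chi v)] and [v] have
    different types; a predicate [P] on all cells does the transport once and for all. Injectivity
    on the open disk then identifies the two coordinates. *)
Lemma cell_coord_ind e (v : 'rV[R]_(cell_dim e))
    (P : forall c : cell S, 'rV[R]_(cell_dim c) -> Prop) :
  enorm v < 1 ->
  P (cell_of (chi v)) (cell_coord (chi v)) -> P e v.
Proof.
move=> v1; have ev : open_cell e (chi v).
  by exists v => //; rewrite open_diskE.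
have := cell_of_unique ev; move: (cell_coord_lt1 (chi v)).
move: (char_map_coord (chi v)); move: (cell_coord (chi v)).
move: (cell_of (chi v)) => c u cu u1 ce.
case: _ / ce v v1 ev cu => v v1 _ uv Pu.
have <- // : u = v.
by apply: (char_map_inj (c := S)) uv; rewrite inE open_diskE.
Qed.

(* Central projection of the cylinder over the unit disk from height 2. *)
Definition proj_height (t r : R) : R := 2 - (2 - t) / r.

(** The ray from height 2 through [(v, t)] leaves the cylinder through the side, where the value is
    that on a lower cell, or through the bottom, where it is given by [f]. The test compares $1/|v|$
    with $2/(2-t)$, the factors at which the ray reaches the side and the bottom. The counter bounds
    the number of descents; for [t] in [[0, 1]] its value 0 is not reached when it starts above the
    dimension. *)
Fixpoint extend_rec (n : nat) (x : X) (t : R) : Z :=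
  if `[< x = point >] then w t else
  if n is n'.+1 then
    if 2 - t <= 2 * enorm (cell_coord x) then
      extend_rec n' (chi ((enorm (cell_coord x))^-1 *: cell_coord x))
        (proj_height t (enorm (cell_coord x)))
    else f (chi ((2 / (2 - t)) *: cell_coord x))
  else f x.

Definition extend (x : X) (t : R) : Z :=
  extend_rec (cell_dim (cell_of x)).+1 x t.

Lemma extend_point t : extend point t = w t.
Proof. by rewrite /extend /= asboolT. Qed.

Lemma sphere_lower_cells e : exists2 C : set (cell S), finite_set C &
  (forall c, C c -> (cell_dim c < cell_dim e)%N) /\
  forall v : 'rV[R]_(cell_dim e), enorm v = 1 ->
    exists2 c, C c & open_cell c (chi v).
Proof.
have [C fC [Cd Cs]] := closure_finite (c := S) e; exists C => //; split => //.
move=> v v1; have /Cs[c Cc cv] : (@char_map _ _ S e @` sphere R _) (chi v).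
  by exists v => //; apply/sphereE.
by exists c.
Qed.

Lemma cell_dim_boundary e (v : 'rV[R]_(cell_dim e)) : enorm v = 1 ->
  (cell_dim (cell_of (chi v)) < cell_dim e)%N.
Proof.
move=> v1; have [C _ [Cd]] := sphere_lower_cells e.
by move=> /(_ v v1)[c Cc /cell_of_unique ->]; exact: Cd.
Qed.

Lemma enorm_normalize n (v : 'rV[R]_n) : 0 < enorm v ->
  enorm ((enorm v)^-1 *: v) = 1.
Proof.
by move=> v0; rewrite enormZ ?invr_ge0 ?ltW // mulVf // gt_eqF.
Qed.

Lemma proj_height_bounds t r : 0 <= t <= 1 -> 2 - t <= 2 * r -> r <= 1 ->
  0 < r /\ 0 <= proj_height t r <= t.
Proof.
move=> /andP[t0 t1] h r1; have r0 : 0 < r by lra.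
split => //; rewrite /proj_height subr_ge0 ler_pdivrMr // h /=.
by rewrite lerBlDr -lerBlDl ler_pdivlMr //; nra.
Qed.

(** Each descent strictly lowers the dimension and keeps the height in [[0, 1]], so two counters
    above the dimension run through the same steps. *)
Lemma extend_rec_stable n n' x t : (cell_dim (cell_of x) < n)%N ->
  (cell_dim (cell_of x) < n')%N -> 0 <= t <= 1 ->
  extend_rec n x t = extend_rec n' x t.
Proof.
elim: n n' x t => // n IH [//|n'] x t; rewrite !ltnS => dn dn' t01 /=.
case: ifP => // _; case: ifP => // h.
have [r0 /andP[p0 pt]] :=
  proj_height_bounds t01 h (ltW (cell_coord_lt1 x)).
have bd := cell_dim_boundary (enorm_normalize r0).
apply: IH; [exact: leq_trans bd dn|exact: leq_trans bd dn'|].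
by rewrite p0 (le_trans pt) //; case/andP: t01.
Qed.

(** On the sphere the formula is trivial, because the projection fixes the side of the cylinder;
    inside, it is one unfolding of the recursion. Continuity over a closed cell needs it on the
    whole closed disk. *)
Lemma extend_char e (v : 'rV[R]_(cell_dim e)) t : e <> e0 -> enorm v <= 1 ->
  0 <= t <= 1 ->
  extend (chi v) t =
    if 2 - t <= 2 * enorm v then
      extend (chi ((enorm v)^-1 *: v)) (proj_height t (enorm v))
    else f (chi ((2 / (2 - t)) *: v)).
Proof.
move=> ee0; rewrite le_eqVlt => /orP[/eqP v1|v1] t01.
  rewrite v1 ifT; last by lra.
  by rewrite /proj_height invr1 scale1r mulr1 (_ : 2 - (2 - t) = t) //; lra.
have ne : chi v <> point.
  move=> vp; apply: ee0.
  by rewrite -(cell_of_unique e0_point) -vp; apply/esym/cell_of_unique;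
    exists v; rewrite // open_diskE.
pose P (c : cell S) (u : 'rV[R]_(cell_dim c)) :=
  extend (chi v) t =
    if 2 - t <= 2 * enorm u then
      extend (chi ((enorm u)^-1 *: u)) (proj_height t (enorm u))
    else f (chi ((2 / (2 - t)) *: u)).
apply: (@cell_coord_ind e v P) => //; rewrite /P.
rewrite {1}/extend /= asboolF //; case: ifP => // h.
have [r0 /andP[p0 pt]] :=
  proj_height_bounds t01 h (ltW (cell_coord_lt1 _)).
apply: extend_rec_stable => //; first exact/cell_dim_boundary/enorm_normalize.
by rewrite p0 (le_trans pt) //; case/andP: t01.
Qed.

Lemma extend_0 x : extend x 0 = f x.
Proof.
have [->|/eqP xp] := eqVneq x point; first by rewrite extend_point fw.
rewrite /extend /= asboolF // ifF.
  have -> : f x = f (chi (cell_coord x)) by rewrite char_map_coord.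
  congr (f (chi _)); rewrite subr0 divff ?pnatr_eq0 //.
  exact: scale1r.
by apply/negbTE; rewrite -ltNge; have := cell_coord_lt1 x; lra.
Qed.

(** Control of the values, by following the recursion; the halo of the base point is read off from
    it. *)
Lemma extend_range x t : 0 <= t <= 1 ->
  (exists y, extend x t = f y) \/ (exists2 s, 0 <= s <= 1 & extend x t = w s).
Proof.
rewrite /extend; move: (cell_dim (cell_of x)).+1 => n.
elim: n x t => [|n IH] x t t01 /=.
  by case: ifP => _; [right; exists t|left; exists x].
case: ifP => _; first by right; exists t.
case: ifP => h; last by left; eexists.
have [r0 /andP[p0 pt]] :=
  proj_height_bounds t01 h (ltW (cell_coord_lt1 x)).
by apply: IH; rewrite p0 (le_trans pt) //; case/andP: t01.
Qed.

Local Notation unitR := [set t : R | 0 <= t <= 1].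

Lemma unitR_closed : closed unitR.
Proof.
have -> : unitR = [set t | 0 <= t] `&` [set t | t <= 1].
  by apply/seteqP; split => t /= => [/andP[]|[-> ->]].
by apply: closedI; [exact: closed_ge|exact: closed_le].
Qed.

Lemma unitR_compact : compact unitR.
Proof.
have -> : unitR = `[0, 1]%classic; last exact: segment_compact.
by apply/seteqP; split => t /=; rewrite in_itv.
Qed.

Lemma closed_cell_compact e : compact (closed_cell (c := S) e).
Proof.
by apply: continuous_compact (@disk_compact _ _); exact: (char_map_continuous (c := S)).
Qed.

Lemma closed_cell_closed e : closed (closed_cell (c := S) e).
Proof. by apply: compact_closed => //; exact: closed_cell_compact. Qed.

Lemma open_cell_sub e x : open_cell (c := S) e x -> closed_cell e x.
Proof.
by move=> [v v1 <-]; exists v => //; rewrite diskE ltW // -open_diskE.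
Qed.

Lemma extend_continuous_e0 :
  {within closed_cell e0 `*` unitR, continuous (fun p => extend p.1 p.2)}.
Proof.
apply: (@eq_within _ _ _ (fun p => w p.2)); last first.
  by apply: within_continuous; apply: (cont_comp cw); cont.
(* In dimension 0 the disk is a single point, so the closed cell of [e0] is the base point. *)
move=> [x t] [/= [v _ vx] _]; suff -> : x = point by rewrite extend_point.
case: e0_point => u _ <-; rewrite -vx; congr chi; apply/rowP => i.
by have := ltn_ord i; rewrite [X in (_ < X)%N]dim_e0.
Qed.

Section Step.
Variable e : cell S.
Hypothesis ee0 : e <> e0.
Hypothesis IH : forall c : cell S, (cell_dim c < cell_dim e)%N ->
  {within closed_cell c `*` unitR, continuous (fun p => extend p.1 p.2)}.
Local Notation D := (disk R (cell_dim e) `*` unitR).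

Lemma D_closed : closed D.
Proof. by apply: closed_setX; [exact: disk_closed|exact: unitR_closed]. Qed.

Lemma D_compact : compact D.
Proof. by apply: compact_setX; [exact: disk_compact|exact: unitR_compact]. Qed.

Lemma extend_continuous_inner :
  {within D `&` [set p | 2 * enorm p.1 <= 2 - p.2],
    continuous (fun p => f (chi ((2 / (2 - p.2)) *: p.1)))}.
Proof.
apply: (within_comp (B := setT)) => //; first exact: within_continuous.
apply: (within_comp (B := disk R _)); first exact: (char_map_continuous (c := S)).
  (* The maximum changes nothing for [t <= 1] and makes the quotient continuous everywhere. *)
  apply: (@eq_within _ _ _ (fun p : 'rV[R]_(cell_dim e) * R =>
    (2 / (Num.max (2 - p.2) 1)) *: p.1)).
    by move=> [v t] [[/= _ /andP[_ t1]] _] /=; rewrite max_l //; lra.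
  apply/within_continuous/cont_scale; cont.
  apply: cont_inv; cont.
  by move=> p; rewrite gt_eqF // lt_max ltr01 orbT.
move=> [v t] [[/= _ /andP[t0 t1]] h]; rewrite diskE enormZ; last first.
  by rewrite divr_ge0 //; lra.
by rewrite mulrAC ler_pdivrMr ?mul1r //; lra.
Qed.

Lemma extend_continuous_outer :
  {within D `&` [set p | 2 - p.2 <= 2 * enorm p.1],
    continuous (fun p => extend (chi ((enorm p.1)^-1 *: p.1))
                           (proj_height p.2 (enorm p.1)))}.
Proof.
have [C fC [Cd Cs]] := sphere_lower_cells e.
(* By closure finiteness the side is sent over finitely many lower closed cells; continuity on their
   union follows from the induction hypothesis. *)
pose B := \bigcup_(c in (C : set {classic cell S}))
  (closed_cell (c : cell S) `*` unitR).
pose g (p : 'rV[R]_(cell_dim e) * R) :=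
  (chi ((enorm p.1)^-1 *: p.1), proj_height p.2 (enorm p.1)).
apply: (within_comp (B := B) (g := fun p : X * R => extend p.1 p.2) (f := g)).
- apply: within_bigcup => // c Cc; last exact: IH (Cd _ Cc).
  by apply: closed_setX; [exact: closed_cell_closed|exact: unitR_closed].
(* From [2 - t <= 2 * enorm v] and [t <= 1] the norm is at least 1/2, so the maximum does not alter
   the inverse there. *)
- have ci : continuous (fun p : 'rV[R]_(cell_dim e) * R =>
      (Num.max (enorm p.1) 2^-1)^-1).
    apply: cont_inv => [|p]; last by rewrite gt_eqF // lt_max invr_gt0 ltr0n orbT.
    by cont; apply: (cont_comp (@enorm_continuous R _)); cont.
  have cin : {within D `&` [set p | 2 - p.2 <= 2 * enorm p.1],
      continuous (fun p => (enorm p.1)^-1)}.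
    apply: eq_within (within_continuous ci) => -[v t] /=.
    by move=> [[_ /andP[t0 t1]] h]; rewrite max_l //; lra.
  have c1 : {within D `&` [set p | 2 - p.2 <= 2 * enorm p.1],
      continuous (fun p => char_map ((enorm p.1)^-1 *: p.1))}.
    apply: (within_comp (B := disk R _)); first exact: (char_map_continuous (c := S)).
      apply: (eq_within (f := fun p : 'rV[R]_(cell_dim e) * R =>
        (Num.max (enorm p.1) 2^-1)^-1 *: p.1)).
        by move=> [v t] [[/= _ /andP[t0 t1]] h]; rewrite max_l //; lra.
      by apply/within_continuous/cont_scale; cont.
    move=> [v t] [[/= v1 /andP[t0 t1]] h]; rewrite diskE enorm_normalize //.
    lra.
  apply: within_pair => //.
  apply: (eq_within (f := fun p : 'rV[R]_(cell_dim e) * R =>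
        2 - (2 - p.2) * (Num.max (enorm p.1) 2^-1)^-1)).
    move=> [v t] [[/= _ /andP[t0 t1]] h]; rewrite max_l //; lra.
  by apply/within_continuous; cont.
- move=> [v t] [[/= v1 t01] h].
  have [r0 /andP[p0 pt]] : 0 < enorm v /\ 0 <= proj_height t (enorm v) <= t.
    by apply: proj_height_bounds => //; rewrite -diskE.
  have [c Cc cv] := Cs _ (enorm_normalize r0).
  exists c => //; split => /=; first exact: open_cell_sub.
  by rewrite p0 (le_trans pt) //; case/andP: t01.
Qed.

(** The cylinder over the compact disk is mapped onto that over the closed cell by a quotient map,
    so continuity is checked upstairs. The two formulas agree where the ray hits the rim, at height
    0. *)
Lemma extend_continuous_step :
  {within closed_cell e `*` unitR, continuous (fun p => extend p.1 p.2)}.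
Proof.
pose g (p : 'rV[R]_(cell_dim e) * R) := (chi p.1, p.2).
have -> : closed_cell e `*` unitR = g @` D.
  apply/seteqP; split => [[x t] [/= [v vD <-] t01]|_ [[v t] [/= vD t01] <-]].
    by exists (v, t).
  by split => //=; exists v.
apply: within_image_compact; [exact: D_compact| | |].
- by apply: hausdorff_prod => //; exact: Rhausdorff.
- apply: within_pair; last exact/within_continuous/cont_snd0.
    apply: (within_comp (B := disk R _) (f := fst)).
    + exact: (char_map_continuous (c := S)).
    + by apply: within_continuous; cont.
    + by move=> q [].
- have h := @within_if R _ _ D (fun p => 2 - p.2) (fun p => 2 * enorm p.1) _ _
    D_closed _ _ extend_continuous_outer extend_continuous_inner.
  apply: eq_within (h _ _ _); first last.
  + move=> [v t] [/= vD /andP[t0 t1]] E.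
    have -> : proj_height t (enorm v) = 0.
      by rewrite /proj_height E mulfK ?subrr // gt_eqF //; lra.
    rewrite extend_0 E; congr (f (chi (_ *: _))).
    by rewrite invfM mulrA divff ?mul1r ?pnatr_eq0.
  + by cont; apply: (cont_comp (@enorm_continuous R _)); cont.
  + by cont.
  + by move=> [v t] [/= + t01]; rewrite diskE => v1; exact/esym/extend_char.
Qed.

End Step.

Lemma extend_continuous_cell (e : cell S) :
  {within closed_cell e `*` unitR, continuous (fun p => extend p.1 p.2)}.
Proof.
have [n] := ubnP (cell_dim e); elim: n e => // n IH e; rewrite ltnS => en.
have [->|ne] := pselect (e = e0); first exact: extend_continuous_e0.
by apply: extend_continuous_step => // c ce; apply: IH; exact: leq_trans ce en.
Qed.

(* The weak topology is carried over to X * [0, 1] by currying. *)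
Lemma homotopy_extension : exists H : X * R -> Z,
  [/\ continuous H, (forall x, H (x, 0) = f x),
      (forall t, 0 <= t <= 1 -> H (point, t) = w t)
    & (forall x t, 0 <= t <= 1 -> (exists y, H (x, t) = f y) \/
         (exists2 s, 0 <= s <= 1 & H (x, t) = w s))].
Proof.
have kc (e : cell S) : continuous (fun p : set_type (closed_cell (c := S) e) *
    unit_interval R => extend (val p.1) (val p.2)).
  apply/continuous_subspace_setT.
  apply: (within_comp (g := fun p : X * R => extend p.1 p.2)
    (f := fun p : set_type (closed_cell e) * unit_interval R => (val p.1, val p.2))
    (@extend_continuous_cell e)).
    apply: within_continuous; cont.
      by apply: cont_comp; [exact: initial_continuous|cont].
    by apply: (cont_comp (@uival_continuous R)); cont.
  by move=> p _; split => /=; [exact: set_valP|exact: ui_bounds].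
pose Hc (x : X) : {compact-open, unit_interval R -> Z} :=
  fun t => extend x (val t).
have cHc : continuous Hc.
  apply/continuous_closedP => W cW; apply: (weak_topology (c := S)) => e.
  have : {within closed_cell e, continuous Hc}.
    by apply/subspace_sigL_continuousP; exact: (cont_curry (@kc e)).
  move=> /continuous_closedP/(_ _ cW)/closed_subspaceP[V cV VW].
  have -> : Hc @^-1` W `&` closed_cell e = V `&` closed_cell e by rewrite VW.
  by apply: closedI => //; exact: closed_cell_closed.
have cx x : continuous (Hc x : unit_interval R -> Z).
  have xe : x \in closed_cell (cell_of x).
    by rewrite inE; apply/open_cell_sub/cell_ofP.
  pose x' : set_type (closed_cell (cell_of x)) := exist _ x xe.
  have := cont_comp (f := fun t => (x', t)) (@kc (cell_of x)).
  by apply; cont.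
exists (fun p => extend p.1 (val (to_ui p.2))); split.
- have := cont_comp (f := fun p : X * R => (p.1, to_ui p.2)) (cont_uncurry cHc cx).
  by apply; cont; apply: (cont_comp (@to_ui_continuous R)); cont.
- by move=> x; rewrite val_to_ui /= ?extend_0 // lexx ler01.
- by move=> t t01; rewrite val_to_ui //= extend_point.
- by move=> x t t01; rewrite val_to_ui //=; exact: extend_range.
Qed.

End HomotopyExtension.

(** A weak form of an NDR pair: [h] has to contract the sublevel [u <= 1] to the base point, and [u]
    may have other zeros. *)
Definition well_pointed (R : realType) (X : ptopologicalType) : Prop :=
  exists (u : X -> R) (h : X * R -> X),
    [/\ continuous u, u point = 0, (forall x, 0 <= u x), continuous h &
        [/\ forall x, h (x, 0) = x, forall t, h (point, t) = point
          & forall x, u x <= 1 -> h (x, 1) = point]].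

Lemma cw_well_pointed (R : realType) (X : ptopologicalType) :
  pointed_cw_complex R X -> well_pointed R X.
Proof.
case=> hX [S [e0 [dim0 e0p]]].
(* With these two maps to [X * R] the extension is a retraction of the cylinder onto the union of
   its bottom and of the segment over the base point. *)
have [||//|H [cH H0 Hp Hr]] := @homotopy_extension R X S hX e0 dim0 e0p (X * R)%type
  (fun x => (x, 0)) (fun t => (point, t)); [by cont..|].
have Hx x : (H (x, 1)).2 <= 1 /\ ((H (x, 1)).2 = 0 \/ (H (x, 1)).1 = point).
  have [|[y ->]|[s /andP[_ s1] ->]] := Hr x 1; first by rewrite lexx ler01.
    by split; [exact: ler01|left].
  by split => //; right.
(* The factor 2 turns [u <= 1] into a height of at least 1/2: the point is then not sent to the
   bottom, hence it goes to the segment over the base point. *)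
exists (fun x => 2 * (1 - (H (x, 1)).2)), (fun p => (H (p.1, val (to_ui p.2))).1).
split.
- by cont; apply: (cont_comp cH); cont.
- by rewrite Hp ?lexx ?ler01 //= subrr mulr0.
- by move=> x; have [h _] := Hx x; lra.
- apply: cont_fst; apply: (cont_comp cH); cont.
  apply: (cont_comp (@uival_continuous R)).
  by apply: (cont_comp (@to_ui_continuous R)); cont.
- split=> [x|t|x ux].
  + by rewrite val_to_ui ?H0 //= lexx ler01.
  + by rewrite Hp //; exact: ui_bounds.
  + rewrite val_to_ui ?lexx ?ler01 //.
    by have [_ [h|//]] := Hx x; exfalso; move: ux; rewrite h; lra.
Qed.

(** * Loop spaces of retracts *)

Section LoopsInFibre.
Variables (R : realType) (Y B : ptopologicalType) (r : pointed_map Y B).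
Local Notation E := (homotopy_fibre R r).
Local Notation OE := (loop_space R E).

Lemma fibre_loopP (e e' : OE) :
  (forall t, 0 <= t <= 1 -> fibre_pt (loop_at e t) = fibre_pt (loop_at e' t)) ->
  (forall t u, 0 <= t <= 1 -> 0 <= u <= 1 ->
     fibre_at (loop_at e t) u = fibre_at (loop_at e' t) u) -> e = e'.
Proof.
by move=> hp ha; apply: loop_atP => t t01; apply: fibreP => [|u u01];
  [exact: hp|exact: ha].
Qed.

(** A loop in the fibre amounts to a loop [base_at] in [Y] together with a null-homotopy [null_at]
    of its image under [r]. *)
Definition base_at (e : OE) (t : R) : Y := fibre_pt (loop_at e t).
Definition null_at (e : OE) (t u : R) : B := fibre_at (loop_at e t) u.

Lemma base_at_continuous (T : topologicalType) (e : T -> OE) (t : T -> R) :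
  continuous e -> continuous t -> continuous (fun z => base_at (e z) (t z)).
Proof.
move=> ce ct; apply: cont_comp (@fibre_pt_continuous _ _ _ r) _.
exact: loop_at_continuous.
Qed.

Lemma null_at_continuous (T : topologicalType) (e : T -> OE) (t u : T -> R) :
  continuous e -> continuous t -> continuous u ->
  continuous (fun z => null_at (e z) (t z) (u z)).
Proof.
move=> ce ct cu; apply: fibre_at_continuous => //.
exact: loop_at_continuous.
Qed.

Lemma base_at_le0 e t : t <= 0 -> base_at e t = point.
Proof. by move=> t0; rewrite /base_at loop_at_le0. Qed.
Lemma base_at_ge1 e t : 1 <= t -> base_at e t = point.
Proof. by move=> t0; rewrite /base_at loop_at_ge1. Qed.
Lemma null_at_le0 e t u : t <= 0 -> null_at e t u = point.
Proof. by move=> t0; rewrite /null_at loop_at_le0. Qed.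
Lemma null_at_ge1 e t u : 1 <= t -> null_at e t u = point.
Proof. by move=> t0; rewrite /null_at loop_at_ge1. Qed.
Lemma null_at_start e t u : u <= 0 -> null_at e t u = point.
Proof. exact: fibre_at_le0. Qed.
Lemma null_at_end e t u : 1 <= u -> null_at e t u = r (base_at e t).
Proof. exact: fibre_at_ge1. Qed.

Section FibreLoopMap.
Variables (T : topologicalType) (a : T * R -> Y) (k : T * R * R -> B).
Hypotheses (ca : continuous a) (ck : continuous k)
  (k0 : forall z, k (z, 0) = point) (k1 : forall z, k (z, 1) = r (a z))
  (a0 : forall z, a (z, 0) = point) (a1 : forall z, a (z, 1) = point)
  (k_0 : forall z u, 0 <= u <= 1 -> k ((z, 0), u) = point)
  (k_1 : forall z u, 0 <= u <= 1 -> k ((z, 1), u) = point).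

Let k' := fibre_map ck k0 k1.

Lemma fibre_loop_map0 z : k' (z, 0) = point.
Proof. by apply: fibreP => [|u u01]; rewrite ?fibre_map_at // ?k_0 //; exact: a0. Qed.

Lemma fibre_loop_map1 z : k' (z, 1) = point.
Proof. by apply: fibreP => [|u u01]; rewrite ?fibre_map_at // ?k_1 //; exact: a1. Qed.

Definition fibre_loop_map : T -> OE :=
  loop_map (@fibre_map_continuous _ _ _ _ _ _ _ ca ck k0 k1)
    fibre_loop_map0 fibre_loop_map1.

Lemma fibre_loop_map_continuous : continuous fibre_loop_map.
Proof. exact: loop_map_continuous. Qed.

Lemma fibre_loop_map_pt z t : 0 <= t <= 1 ->
  fibre_pt (loop_at (fibre_loop_map z) t) = a (z, t).
Proof. by move=> t01; rewrite loop_map_at. Qed.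

Lemma fibre_loop_map_at z t u : 0 <= t <= 1 -> 0 <= u <= 1 ->
  fibre_at (loop_at (fibre_loop_map z) t) u = k ((z, t), u).
Proof. by move=> t01 u01; rewrite loop_map_at // fibre_map_at. Qed.

End FibreLoopMap.
End LoopsInFibre.

Lemma cont_uival (R : realType) (T : topologicalType) (f : T -> unit_interval R) :
  continuous f -> continuous (fun z => val (f z) : R).
Proof. exact: cont_comp (@uival_continuous R). Qed.

Lemma cont_pointed (T : topologicalType) (A B : ptopologicalType)
    (g : pointed_map A B) (f : T -> A) :
  continuous f -> continuous (fun z => g (f z)).
Proof. exact: cont_comp (@pointed_fun_continuous _ _ g). Qed.

Lemma cont_fibre_pt (R : realType) (T : topologicalType) (A B : ptopologicalType)
    (g : pointed_map A B) (f : T -> homotopy_fibre R g) :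
  continuous f -> continuous (fun z => fibre_pt (f z)).
Proof. exact: cont_comp (@fibre_pt_continuous _ _ _ g). Qed.

Ltac cont_hook ::=
  lazymatch goal with
  | |- forall x, @continuous_at _ _ x (fun z => loop_at _ _) =>
      apply: loop_at_continuous
  | |- forall x, @continuous_at _ _ x (fun z => fibre_at _ _) =>
      apply: fibre_at_continuous
  | |- forall x, @continuous_at _ _ x (fun z => fibre_pt _) => apply: cont_fibre_pt
  | |- forall x, @continuous_at _ _ x (fun z => base_at _ _) =>
      apply: base_at_continuous
  | |- forall x, @continuous_at _ _ x (fun z => null_at _ _ _) =>
      apply: null_at_continuous
  | |- forall x, @continuous_at _ _ x (@fibre_pt _ _ _ _) =>
      exact: fibre_pt_continuous
  | |- forall x, @continuous_at _ _ x (fun z => pointed_fun _ _) =>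
      apply: cont_pointed
  | |- forall x, @continuous_at _ _ x (fun z => if (_ <= _)%R then _ else _) =>
      apply: cont_if
  | |- forall x, @continuous_at _ _ x _ => apply: cont_uival
  end.

(** * Splitting the loop space of a space with a retraction *)

Section LoopSplitting.
Variables (R : realType) (Y B : ptopologicalType).
Variables (r : pointed_map Y B) (s : pointed_map B Y).
Hypothesis rs : forall b, r (s b) = b.
Local Notation I := (unit_interval R).
Local Notation E := (homotopy_fibre R r).
Local Notation OY := (loop_space R Y).
Local Notation OB := (loop_space R B).
Local Notation OE := (loop_space R E).

Let r0 : r point = point. Proof. exact: pointed_fun_point. Qed.
Let s0 : s point = point. Proof. exact: pointed_fun_point. Qed.

Definition merge_fun (p : OB * OE * R) : Y :=
  if p.2 <= 2^-1 then s (loop_at p.1.1 (2 * p.2)) else base_at p.1.2 (2 * p.2 - 1).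

Lemma merge_fun_continuous : continuous merge_fun.
Proof.
rewrite /merge_fun; cont => -[[be e] t] /= ->.
by rewrite loop_at_ge1 ?s0 ?base_at_le0 //; lra.
Qed.

Lemma merge_fun0 z : merge_fun (z, 0) = point.
Proof. by rewrite /merge_fun /= ifT ?loop_at_le0 //; lra. Qed.

Lemma merge_fun1 z : merge_fun (z, 1) = point.
Proof.
rewrite /merge_fun /= ifF ?base_at_ge1 //; first by lra.
by apply/negbTE; rewrite -ltNge; lra.
Qed.

Definition merge : OB * OE -> OY := loop_map merge_fun_continuous merge_fun0 merge_fun1.

Lemma merge_point : merge point = point.
Proof.
apply: loop_atP => t t01; rewrite loop_map_at // /merge_fun /=.
by case: ifP.
Qed.

Lemma proj_loop_continuous : continuous (fun p : OY * R => r (loop_at p.1 p.2)).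
Proof. by cont. Qed.
Lemma proj_loop0 (z : OY) : r (loop_at z 0) = point.
Proof. by rewrite loop_at_le0. Qed.
Lemma proj_loop1 (z : OY) : r (loop_at z 1) = point.
Proof. by rewrite loop_at_ge1. Qed.

Definition proj_loop : OY -> OB := loop_map proj_loop_continuous proj_loop0 proj_loop1.

Definition defect_base (p : OY * R) : Y :=
  if p.2 <= 2^-1 then s (r (loop_at p.1 (1 - 2 * p.2))) else loop_at p.1 (2 * p.2 - 1).
(** The image of [defect_base] under [r] is [r eta] run backwards and then forwards, that is, at
    time [|1 - 2 t|]; the maximum with [1 - 2 u] cuts it back to the end of [eta]. *)
Definition defect_null (p : OY * R * R) : B :=
  r (loop_at p.1.1 (Num.max `|1 - 2 * p.1.2| (1 - 2 * p.2))).

Lemma defect_base_continuous : continuous defect_base.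
Proof.
rewrite /defect_base; cont => -[e t] /= ->.
by rewrite !loop_at_le0 ?r0 ?s0 //; lra.
Qed.

Lemma defect_null_continuous : continuous defect_null.
Proof. by rewrite /defect_null; cont. Qed.

Lemma defect_null0 z : defect_null (z, 0) = point.
Proof.
by rewrite /defect_null /= loop_at_ge1 // le_max; apply/orP; right; lra.
Qed.

Lemma defect_null1 z : defect_null (z, 1) = r (defect_base z).
Proof.
rewrite /defect_null /defect_base /= max_l; last by have := normr_ge0 (1 - 2 * z.2); lra.
have [t2|t2] := leP z.2 2^-1.
  by rewrite rs ger0_norm //; lra.
by rewrite ler0_norm ?opprB //; lra.
Qed.

Lemma defect_base0 z : defect_base (z, 0) = point.
Proof. by rewrite /defect_base /= ifT ?loop_at_ge1 ?r0 ?s0 //; lra. Qed.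

Lemma defect_base1 z : defect_base (z, 1) = point.
Proof.
rewrite /defect_base /= ifF ?loop_at_ge1 //; first by lra.
by apply/negbTE; rewrite -ltNge; lra.
Qed.

Lemma defect_null_0 z u : 0 <= u <= 1 -> defect_null ((z, 0), u) = point.
Proof.
move=> u01; rewrite /defect_null /= loop_at_ge1 // le_max; apply/orP; left.
by rewrite ger0_norm; lra.
Qed.

Lemma defect_null_1 z u : 0 <= u <= 1 -> defect_null ((z, 1), u) = point.
Proof.
move=> u01; rewrite /defect_null /= loop_at_ge1 // le_max; apply/orP; left.
by rewrite ler0_norm; lra.
Qed.

(* The loop inverse (s r eta)^-1 * eta, which lies over a canonically null
   loop. *)
Definition defect : OY -> OE :=
  fibre_loop_map defect_base_continuous defect_null_continuous
    defect_null0 defect_null1 defect_base0 defect_base1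
    defect_null_0 defect_null_1.

Lemma proj_loop_point : proj_loop point = point.
Proof. by apply: loop_atP => t t01; rewrite loop_map_at. Qed.

Lemma defect_point : defect point = point.
Proof.
apply: fibre_loopP => [t t01|t u t01 u01].
  by rewrite fibre_loop_map_pt // /defect_base; case: ifP => _ //=; rewrite r0 s0.
by rewrite fibre_loop_map_at // /defect_null /= r0.
Qed.


Lemma merge_continuous : continuous merge.
Proof. exact: loop_map_continuous. Qed.
Lemma proj_loop_map_continuous : continuous proj_loop.
Proof. exact: loop_map_continuous. Qed.
Lemma defect_continuous : continuous defect.
Proof. exact: fibre_loop_map_continuous. Qed.

(** At parameter 0 this is [s r eta], its inverse and [eta], run on [[0, 1/2]], [[1/2, 3/4]] and
    [[3/4, 1]], as the two successive concatenations prescribe. Capping the time cancels the first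
    two; [cancel2_fun] then stretches [eta] over the whole interval. *)
Definition cancel1_fun (p : OY * I * R) : Y :=
  if p.2 <= 3 / 4 then
    s (r (loop_at p.1.1 (Num.min (Num.min (2 * p.2) (3 - 4 * p.2)) (1 - val p.1.2))))
  else loop_at p.1.1 (4 * p.2 - 3).

Definition cancel2_fun (p : OY * I * R) : Y :=
  loop_at p.1.1 ((1 - val p.1.2) * Num.max 0 (4 * p.2 - 3) + val p.1.2 * p.2).

Lemma cancel1_continuous : continuous cancel1_fun.
Proof.
rewrite /cancel1_fun; cont => -[[eta l] t] /= ->.
rewrite !loop_at_le0 ?r0 ?s0 //; first by lra.
by rewrite !ge_min; apply/orP; left; apply/orP; right; lra.
Qed.

Lemma cancel2_continuous : continuous cancel2_fun.
Proof. by rewrite /cancel2_fun; cont. Qed.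

Lemma cancel1_0 z : cancel1_fun (z, 0) = point.
Proof.
rewrite /cancel1_fun /= ifT; last by lra.
by rewrite loop_at_le0 ?r0 ?s0 // !ge_min; apply/orP; left; apply/orP; left; lra.
Qed.

Lemma cancel1_1 z : cancel1_fun (z, 1) = point.
Proof.
rewrite /cancel1_fun /= ifF; first by rewrite loop_at_ge1 //; lra.
by apply/negbTE; rewrite -ltNge; lra.
Qed.

Lemma cancel2_0 z : cancel2_fun (z, 0) = point.
Proof. by rewrite /cancel2_fun /= max_l ?loop_at_le0 //; lra. Qed.

Lemma cancel2_1 z : cancel2_fun (z, 1) = point.
Proof. by rewrite /cancel2_fun /= max_r ?loop_at_ge1 //; lra. Qed.

Lemma merge_split_homotopic :
  pointed_homotopic R (fun eta => merge (proj_loop eta, defect eta)) id.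
Proof.
pose H1 := loop_map cancel1_continuous cancel1_0 cancel1_1.
pose H2 := loop_map cancel2_continuous cancel2_0 cancel2_1.
apply: (@pointed_homotopic_trans _ _ _ _ (fun eta => H1 (eta, one))).
  exists H1; split => //.
  - exact: loop_map_continuous.
  - move=> eta; apply: loop_atP => t t01; rewrite !loop_map_at //.
    rewrite /cancel1_fun /merge_fun /= subr0.
    have [t2|t2] := leP t 2^-1.
      rewrite ifT; last by lra.
      rewrite loop_map_at; last by lra.
      congr (s (r (loop_at _ _))).
      by rewrite (min_l (x := 2 * t)) ?min_l //; lra.
    rewrite /base_at fibre_loop_map_pt; last by lra.
    rewrite /defect_base /=; have [t3|t3] := leP t (3 / 4).
      rewrite ifT; last by lra.
      congr (s (r (loop_at _ _))).
      by rewrite (min_r (x := 2 * t)) ?min_l //; lra.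
    rewrite ifF; last by apply/negbTE; rewrite -ltNge; lra.
    by congr loop_at; lra.
  - move=> l; apply: loop_atP => t t01; rewrite loop_map_at //.
    by rewrite /cancel1_fun /=; case: ifP => //; rewrite r0 s0.
exists H2; split => //.
- exact: loop_map_continuous.
- move=> eta; apply: loop_atP => t t01; rewrite !loop_map_at //.
  rewrite /cancel1_fun /cancel2_fun /= subrr subr0 mul1r mul0r addr0.
  have [t3|t3] := leP t (3 / 4).
    rewrite max_l; last by lra.
    by rewrite !loop_at_le0 ?r0 ?s0 // ge_min lexx orbT.
  by rewrite max_r //; lra.
- move=> eta; apply: loop_atP => t t01; rewrite loop_map_at //.
  by rewrite /cancel2_fun /= subrr mul0r add0r mul1r.
- by move=> l; apply: loop_atP => t t01; rewrite loop_map_at.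
Qed.

Definition split1_loop (p : OB * OE * I * R) : B :=
  if p.2 <= 2^-1 then loop_at p.1.1.1 (2 * p.2)
  else null_at p.1.1.2 (2 * p.2 - 1) (1 - val p.1.2).

(** At parameter 0 this is [defect_base] of the merged loop. As the parameter grows, the loop coming
    from [B] cancels against its inverse by the maximum, and the image of the fibre loop under [s r]
    is contracted along [null_at]; the loop [base_at] itself remains, on [[3/4, 1]]. *)
Definition split1_base (p : OB * OE * I * R) : Y :=
  if `|1 - 2 * p.2| <= 2^-1 then
    s (loop_at p.1.1.1 (Num.max (2 * `|1 - 2 * p.2|) (val p.1.2)))
  else if p.2 <= 2^-1 then
    s (null_at p.1.1.2 (2 * `|1 - 2 * p.2| - 1) (1 - val p.1.2))
  else base_at p.1.1.2 (2 * `|1 - 2 * p.2| - 1).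

(** In the last branch [Num.max 0 (2 * p.2 - 1)] is 0 for [p.2 <= 1/2], hence agreement with the
    previous branch at [p.1.2 = 1/2], where larger values of [p.2] give [c = 0]; it is 1 at
    [p.2 = 1], as the end point of the path requires. *)
Definition split1_null (p : OB * OE * I * R * R) : B :=
  let c := Num.max `|1 - 2 * p.1.2| (1 - 2 * p.2) in
  if c <= 2^-1 then loop_at p.1.1.1.1 (Num.max (2 * c) (val p.1.1.2))
  else if p.1.2 <= 2^-1 then
    null_at p.1.1.1.2 (2 * c - 1) (1 - val p.1.1.2)
  else null_at p.1.1.1.2 (2 * c - 1)
         (1 - val p.1.1.2 + val p.1.1.2 * Num.max 0 (2 * p.2 - 1)).

Lemma split1_loop_continuous : continuous split1_loop.
Proof.
rewrite /split1_loop; cont => -[[z l] t] /= ->.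
by rewrite loop_at_ge1 ?null_at_le0 //; lra.
Qed.

Lemma split1_base_continuous : continuous split1_base.
Proof.
rewrite /split1_base; cont.
  by move=> [[z l] t] /= ->; rewrite null_at_le0 ?base_at_le0 ?s0 //;
    rewrite divff ?subrr ?normr0 ?pnatr_eq0 //; lra.
move=> [[z l] t] /= ->.
rewrite loop_at_ge1 ?s0; last by rewrite le_max; apply/orP; left; lra.
by rewrite null_at_le0 ?base_at_le0 ?s0 ?if_same //; lra.
Qed.

Lemma split1_null_continuous : continuous split1_null.
Proof.
rewrite /split1_null /=; cont.
  move=> [[[z l] t] u] /= ->.
  rewrite divff ?subrr ?normr0 ?pnatr_eq0 //.
  have [u2|u2] := leP u 2^-1.
    by rewrite (max_l (x := 0) (y := 2 * u - 1)) ?mulr0 ?addr0 //; lra.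
  by rewrite (max_l (x := 0)) ?null_at_le0 //; lra.
move=> [[[z l] t] u] /= ->.
rewrite loop_at_ge1; last by rewrite le_max; apply/orP; left; lra.
by rewrite !null_at_le0 ?if_same //; lra.
Qed.

(** The three [split2] maps only reparametrize, from what [split1] leaves at parameter 1 to the
    identity. *)
Definition split2_loop (p : OB * OE * I * R) : B :=
  loop_at p.1.1.1 ((2 - val p.1.2) * p.2).
Definition split2_base (p : OB * OE * I * R) : Y :=
  base_at p.1.1.2 ((1 - val p.1.2) * Num.max 0 (4 * p.2 - 3) + val p.1.2 * p.2).
Definition split2_null (p : OB * OE * I * R * R) : B :=
  null_at p.1.1.1.2
    ((1 - val p.1.1.2) * Num.max 0 (4 * p.1.2 - 3) + val p.1.1.2 * p.1.2)
    ((1 - val p.1.1.2) * Num.max 0 (2 * p.2 - 1) + val p.1.1.2 * p.2).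

Lemma split2_loop_continuous : continuous split2_loop.
Proof. by rewrite /split2_loop; cont. Qed.
Lemma split2_base_continuous : continuous split2_base.
Proof. by rewrite /split2_base; cont. Qed.
Lemma split2_null_continuous : continuous split2_null.
Proof. by rewrite /split2_null; cont. Qed.


Lemma split1_loop0 z : split1_loop (z, 0) = point.
Proof. by rewrite /split1_loop /= ifT ?loop_at_le0 //; lra. Qed.
Lemma split1_loop1 z : split1_loop (z, 1) = point.
Proof.
rewrite /split1_loop /= ifF ?null_at_ge1 //; first by lra.
by apply/negbTE; rewrite -ltNge; lra.
Qed.

Lemma split1_null0 z : split1_null (z, 0) = point.
Proof.
have c1 : 1 <= Num.max `|1 - 2 * z.2| (1 - 2 * 0) by rewrite le_max; apply/orP; right; lra.
rewrite /split1_null /= ifF; last by apply/negbTE; rewrite -ltNge; lra.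
by rewrite !null_at_ge1 ?if_same //; lra.
Qed.

Lemma split1_null1 z : split1_null (z, 1) = r (split1_base z).
Proof.
have c1 : Num.max `|1 - 2 * z.2| (1 - 2 * 1) = `|1 - 2 * z.2|.
  by rewrite max_l //; have := normr_ge0 (1 - 2 * z.2); lra.
rewrite /split1_null /split1_base /= c1; case: ifP => _; first by rewrite rs.
case: ifP => _; first by rewrite rs.
by rewrite null_at_end // max_r; lra.
Qed.

Lemma split1_base0 z : split1_base (z, 0) = point.
Proof.
rewrite /split1_base /= ifF; last first.
  by apply/negbTE; rewrite -ltNge mulr0 subr0 normr1; lra.
by rewrite mulr0 subr0 normr1 null_at_ge1 ?base_at_ge1 ?s0 ?if_same //; lra.
Qed.

Lemma norm_at1 : `|1 - 2 * 1| = 1 :> R.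
Proof. by rewrite ler0_norm; lra. Qed.

Lemma split1_base1 z : split1_base (z, 1) = point.
Proof.
rewrite /split1_base /= norm_at1 ifF; last by apply/negbTE; rewrite -ltNge; lra.
by rewrite null_at_ge1 ?base_at_ge1 ?s0 ?if_same //; lra.
Qed.

Lemma split1_null_far z t u : `|1 - 2 * t| = 1 -> split1_null ((z, t), u) = point.
Proof.
move=> t1; have c1 : 1 <= Num.max `|1 - 2 * t| (1 - 2 * u) by rewrite le_max t1 lexx.
rewrite /split1_null /= ifF; last by apply/negbTE; rewrite -ltNge; lra.
by rewrite !null_at_ge1 ?if_same //; lra.
Qed.

Lemma split1_null_0 z u : 0 <= u <= 1 -> split1_null ((z, 0), u) = point.
Proof. by move=> _; rewrite split1_null_far // mulr0 subr0 normr1. Qed.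

Lemma split1_null_1 z u : 0 <= u <= 1 -> split1_null ((z, 1), u) = point.
Proof. by move=> _; rewrite split1_null_far // norm_at1. Qed.

Lemma split2_loop0 z : split2_loop (z, 0) = point.
Proof. by rewrite /split2_loop /= mulr0 loop_at_le0. Qed.
Lemma split2_loop1 z : split2_loop (z, 1) = point.
Proof.
rewrite /split2_loop /= loop_at_ge1 //.
by have : 0 <= sval z.2 <= 1 := ui_bounds z.2; lra.
Qed.

Lemma split2_param0 l : (1 - l) * Num.max 0 (4 * 0 - 3) + l * 0 = 0 :> R.
Proof. by rewrite max_l; lra. Qed.
Lemma split2_param1 l : (1 - l) * Num.max 0 (4 * 1 - 3) + l * 1 = 1 :> R.
Proof. by rewrite max_r; lra. Qed.

Lemma split2_base0 z : split2_base (z, 0) = point.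
Proof. by rewrite /split2_base /= split2_param0 base_at_le0. Qed.
Lemma split2_base1 z : split2_base (z, 1) = point.
Proof. by rewrite /split2_base /= split2_param1 base_at_ge1. Qed.
Lemma split2_null_0 z u : 0 <= u <= 1 -> split2_null ((z, 0), u) = point.
Proof. by move=> _; rewrite /split2_null /= split2_param0 null_at_le0. Qed.
Lemma split2_null_1 z u : 0 <= u <= 1 -> split2_null ((z, 1), u) = point.
Proof. by move=> _; rewrite /split2_null /= split2_param1 null_at_ge1. Qed.
Lemma split2_null0 z : split2_null (z, 0) = point.
Proof.
rewrite /split2_null /= (max_l (x := 0) (y := 2 * 0 - 1)); last by lra.
by rewrite !mulr0 addr0 null_at_start.
Qed.
Lemma split2_null1 z : split2_null (z, 1) = r (split2_base z).
Proof.
rewrite /split2_null /= (max_r (x := 0) (y := 2 * 1 - 1)); last by lra.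
by rewrite null_at_end //; lra.
Qed.

Lemma split_merge_homotopic :
  pointed_homotopic R (fun z => (proj_loop (merge z), defect (merge z))) id.
Proof.
pose K1 z := (loop_map split1_loop_continuous split1_loop0 split1_loop1 z,
  fibre_loop_map split1_base_continuous split1_null_continuous split1_null0
    split1_null1 split1_base0 split1_base1 split1_null_0 split1_null_1 z).
pose K2 z := (loop_map split2_loop_continuous split2_loop0 split2_loop1 z,
  fibre_loop_map split2_base_continuous split2_null_continuous split2_null0
    split2_null1 split2_base0 split2_base1 split2_null_0 split2_null_1 z).
have mergeE z t : 0 <= t <= 1 -> loop_at (merge z) t = merge_fun (z, t).
  exact: loop_map_at.
have normE (t : R) : 0 <= t <= 1 -> 0 <= `|1 - 2 * t| <= 1.
  move=> t01; apply/andP; split; first exact: normr_ge0.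
  by rewrite ler_norml; apply/andP; split; lra.
apply: (@pointed_homotopic_trans _ _ _ _ (fun z => K1 (z, one))).
  exists K1; split => //.
  - apply: cont_pair; [exact: loop_map_continuous|exact: fibre_loop_map_continuous].
  - move=> z; congr (_, _).
      apply: loop_atP => t t01; rewrite !loop_map_at //.
      rewrite /split1_loop /merge_fun /=.
      by case: ifP => _; rewrite ?rs // null_at_end //; lra.
    apply: fibre_loopP => [t t01|t u t01 u01].
      have t01' := normE t t01.
      rewrite !fibre_loop_map_pt //.
      rewrite /split1_base /defect_base /=.
      have [t2|t2] := leP t 2^-1.
        rewrite mergeE; last by lra.
        rewrite /merge_fun /= (ger0_norm (x := 1 - 2 * t)); last by lra.
        rewrite (max_l (x := 2 * (1 - 2 * t))); last by lra.
        by case: ifP => _; rewrite ?rs // null_at_end //; lra.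
      rewrite mergeE; last by lra.
      rewrite /merge_fun /= (ler0_norm (x := 1 - 2 * t)) ?opprB; last by lra.
      by rewrite max_l //; lra.
    have t01' := normE t t01.
    rewrite !fibre_loop_map_at //.
    rewrite /split1_null /defect_null /=.
    set c := Num.max _ _; have c01 : 0 <= c <= 1.
      by rewrite /c le_max ge_max; lra.
    rewrite mergeE // /merge_fun /= (max_l (x := 2 * c)); last by lra.
    by case: ifP => _; rewrite ?rs // mul0r addr0 if_same null_at_end //; lra.
  - move=> l; congr (_, _).
      apply: loop_atP => t t01; rewrite !loop_map_at //.
      by rewrite /split1_loop /=; case: ifP.
    apply: fibre_loopP => [t t01|t u t01 u01].
      rewrite fibre_loop_map_pt // /split1_base /=.
      by case: ifP => _ //; case: ifP.
    rewrite fibre_loop_map_at // /split1_null /=.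
    by case: ifP => _ //; case: ifP.
exists K2; split => //.
- apply: cont_pair; [exact: loop_map_continuous|exact: fibre_loop_map_continuous].
- move=> z; congr (_, _).
    apply: loop_atP => t t01; rewrite !loop_map_at //.
    rewrite /split1_loop /split2_loop /= subr0 subrr.
    case: ifPn => //; rewrite -ltNge => t2.
    by rewrite loop_at_ge1 ?null_at_start //; lra.
  apply: fibre_loopP => [t t01|t u t01 u01].
    have t01' := normE t t01.
    rewrite !fibre_loop_map_pt //.
    rewrite /split1_base /split2_base /= subr0 subrr mul1r mul0r addr0.
    have [t3|t3] := leP t (3 / 4).
      rewrite max_l; last by lra.
      rewrite [LHS]base_at_le0 //.
      case: ifPn => [_|]; first by rewrite loop_at_ge1 ?s0 // le_max lexx orbT.
      rewrite -ltNge => h; rewrite null_at_start // s0.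
      have [//|t2] := leP t 2^-1; exfalso; move: h; rewrite ler0_norm; lra.
    rewrite max_r; last by lra.
    rewrite ler0_norm ?opprB; last by lra.
    rewrite ifF; last by apply/negbTE; rewrite -ltNge; lra.
    rewrite ifF; last by apply/negbTE; rewrite -ltNge; lra.
    by congr base_at; lra.
  have t01' := normE t t01.
  rewrite !fibre_loop_map_at //.
  rewrite /split1_null /split2_null /= subr0 subrr !mul1r !mul0r !addr0 add0r.
  have [t3|t3] := leP t (3 / 4).
    rewrite (max_l (x := 0) (y := 4 * t - 3)); last by lra.
    rewrite [LHS]null_at_le0 //.
    case: ifPn => [_|]; first by rewrite loop_at_ge1 // le_max lexx orbT.
    rewrite -ltNge => h; rewrite null_at_start //.
    have [//|t2] := leP t 2^-1; move: h; rewrite lt_max => /orP[h|h].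
      by exfalso; move: h; rewrite ler0_norm; lra.
    by rewrite null_at_start // max_l //; lra.
  rewrite ler0_norm ?opprB; last by lra.
  rewrite ifF; last by apply/negbTE; rewrite -ltNge lt_max; apply/orP; left; lra.
  rewrite ifF; last by apply/negbTE; rewrite -ltNge; lra.
  have [u2|u2] := leP u 2^-1.
    by rewrite (max_l (x := 0) (y := 2 * u - 1)) ?null_at_start //; lra.
  congr null_at; rewrite (max_r (x := 0)); last by lra.
  by rewrite max_l; lra.
- case=> be e; congr (_, _).
    apply: loop_atP => t t01; rewrite loop_map_at // /split2_loop /=.
    by congr loop_at; lra.
  apply: fibre_loopP => [t t01|t u t01 u01].
    by rewrite fibre_loop_map_pt // /split2_base /= subrr mul0r add0r mul1r.
  by rewrite fibre_loop_map_at // /split2_null /= subrr !mul0r !add0r !mul1r.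
- move=> l; congr (_, _); first by apply: loop_atP => t t01; rewrite loop_map_at.
  apply: fibre_loopP => [t t01|t u t01 u01].
    by rewrite fibre_loop_map_pt.
  by rewrite fibre_loop_map_at.
Qed.

Theorem loop_space_splits : homotopy_equivalent R OY (OB * OE)%type.
Proof.
have csplit : continuous (fun eta => (proj_loop eta, defect eta) : OB * OE).
  by apply: cont_pair; [exact: proj_loop_map_continuous|exact: defect_continuous].
have psplit : (proj_loop point, defect point) = point :> OB * OE.
  by rewrite proj_loop_point defect_point.
exists (PointedMap csplit psplit), (PointedMap merge_continuous merge_point).
by split; [exact: merge_split_homotopic|exact: split_merge_homotopic].
Qed.

End LoopSplitting.

(** * Unions of contractible spaces *)

Section WedgeOfSuspensions.
Variables (R : realType) (G : ptopologicalType) (n : nat).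
Local Notation I := (unit_interval R).
Local Notation W := (pwedge (fun _ : 'I_n.+1 => suspension R G)).

(** [inord] allows a natural number as index, so that the recursion over the copies involves no
    bounded type. *)
Definition wedge_in (j : nat) (p : G * R) : W :=
  @wedge_lift _ (fun _ : 'I_n.+1 => suspension R G) (fun=> point) (inord j)
    (\pi_(suspension R G) (p.1, to_ui p.2))%qT.

Lemma wedge_in_continuous j : continuous (wedge_in j).
Proof.
rewrite /wedge_in.
apply: (cont_comp (@wedge_lift_continuous _ (fun _ : 'I_n.+1 => suspension R G) (fun=> point)
  (inord j))).
apply: (cont_comp (@pi_continuous _ (suspension R G))); cont.
by apply: (cont_comp (@to_ui_continuous R)); cont.
Qed.

Lemma wedge_in_base j g t : g = point \/ t <= 0 \/ 1 <= t ->
  wedge_in j (g, t) = point.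
Proof.
move=> h; rewrite /wedge_in.
have -> : \pi_(suspension R G)%qT (g, to_ui t) = (point : suspension R G).
  apply/eqmodP; rewrite /= /collapse_eq; apply/orP; right.
  apply/andP; split; rewrite inE /suspension_base /=; last first.
    exact: Or31.
  case: h => [|[]] h; first exact: Or31.
    by apply: Or32; exact: to_ui_le0.
  by apply: Or33; exact: to_ui_ge1.
exact: (@wedge_liftE _ (fun _ : 'I_n.+1 => suspension R G) (fun=> point)
  point point (inord j) point).
Qed.

Lemma wedge_in_surj (w : W) : exists (j : 'I_n.+1) (g : G) (t : R),
  0 <= t <= 1 /\ w = wedge_in j (g, t).
Proof.
have [j _ [x _ <-]] : (\bigcup_j range (@wedge_lift _
    (fun _ : 'I_n.+1 => suspension R G) (fun=> point) j)) w.
  by rewrite wedgeTE.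
exists j, (repr x).1, (val (repr x).2); split; first exact: ui_bounds.
rewrite /wedge_in /= uivalK inord_val; congr wedge_lift.
by rewrite -surjective_pairing reprK.
Qed.

Section Elimination.
Variables (T : topologicalType) (b : T) (f : nat -> G * I -> T).
Hypothesis cf : forall j, (j <= n)%N -> continuous (f j).
Hypothesis fb : forall j g t, (j <= n)%N ->
  g = point \/ t = zero \/ t = one -> f j (g, t) = b.

Definition wedge_elim : W -> T :=
  wedge_fun (fun (j : 'I_n.+1) => f j \o (repr : suspension R G -> G * I)).

Lemma wedge_elim_repr (j : 'I_n.+1) (p : G * I) :
  f j (repr (\pi_(suspension R G) p)%qT) = f j p.
Proof.
have : (\pi_(suspension R G) (repr (\pi_(suspension R G) p)) = \pi_(suspension R G) p)%qT.
  by rewrite reprK.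
move: (repr _) => q /eqmodP; rewrite /= /collapse_eq => /orP[/eqP->//|].
have base q' : q' \in suspension_base (R := R) (Y := G) -> f j q' = b.
  rewrite inE; case: q' => g t h; apply: fb; first by rewrite -ltnS.
  by case: h => /= ->; [left|right; left|right; right].
by move=> /andP[/base -> /base ->].
Qed.

Lemma wedge_elimE (j : 'I_n.+1) g t :
  wedge_elim (wedge_in j (g, t)) = f j (g, to_ui t).
Proof.
rewrite /wedge_elim /wedge_in wedge_lift_funE.
  by rewrite inord_val /= wedge_elim_repr.
by move=> i k /=; rewrite !wedge_elim_repr !fb ?(ltnSE (ltn_ord _)) //; left.
Qed.

Lemma wedge_elim_continuous : continuous wedge_elim.
Proof.
apply: wedge_fun_continuous => [j|i k].
  apply: repr_comp_continuous; first by apply: cf; rewrite -ltnS.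
  by move=> p q /eqP pq; rewrite -(wedge_elim_repr j p) pq wedge_elim_repr.
by rewrite /= !wedge_elim_repr !fb ?(ltnSE (ltn_ord _)) //; left.
Qed.

End Elimination.

(** The homotopy is curried, [wedge_elim] is applied with values in the function space, and the
    result is uncurried; the product of the quotient map with the interval is not considered. *)
Lemma wedge_elim_homotopy (T : ptopologicalType) (f : nat -> G * R * I -> T) :
  (forall j, (j <= n)%N -> continuous (f j)) ->
  (forall j g t s, (j <= n)%N -> g = point \/ t = 0 \/ t = 1 ->
     f j (g, t, s) = point) ->
  exists H : W * I -> T, continuous H /\
    forall (j : 'I_n.+1) g t s, 0 <= t <= 1 ->
      H (wedge_in j (g, t), s) = f j (g, t, s).
Proof.
move=> cf fb.
pose f' j (p : G * I) : {compact-open, I -> T} :=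
  fun s => f j (p.1, val p.2, s).
pose b0 : {compact-open, I -> T} := fun=> point.
have cf' j : (j <= n)%N -> continuous (f' j).
  move=> jn; apply: (cont_curry (f := fun q : G * I * I => f j (q.1.1, val q.1.2, q.2))).
  apply: (cont_comp (cf j jn)); cont.
have fb' j g t : (j <= n)%N -> g = point \/ t = zero \/ t = one ->
    f' j (g, t) = b0.
  move=> jn h; apply/funext => s; rewrite /f' /= fb //.
  by case: h => [|[] ->]; [left|right; left|right; right].
have fz w : continuous (wedge_elim f' w : I -> T).
  have [j [g [t [t01 ->]]]] := wedge_in_surj w.
  rewrite (wedge_elimE (b := b0)) // /f' /=.
  have jn : (j <= n)%N by rewrite -ltnS.
  by apply: (cont_comp (cf j jn)); cont.
exists (fun p => wedge_elim f' p.1 p.2); split.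
  exact: cont_uncurry (wedge_elim_continuous (b := b0) cf' fb') fz.
move=> j g t s t01; rewrite [LHS](_ : _ = f' j (g, to_ui t) s).
  by rewrite /f' [X in (_, X, _)](val_to_ui t01).
by rewrite -(wedge_elimE (b := b0)).
Qed.

End WedgeOfSuspensions.

(** * A chain of contractible copies is a wedge of suspensions *)

Section GluedContractibles.
Variables (R : realType) (P G F : ptopologicalType) (n : nat).
Local Notation I := (unit_interval R).
Local Notation W := (pwedge (fun _ : 'I_n.+1 => suspension R G)).

(* [F] is the union of the copies [iota k P], [k <= n.+1], the copies [j] and
   [j.+1] meeting along [e j G].  The pair [(d j, H)] is a halo of [e j G] in
   [P]: [H _ 1] retracts [d j <= 1] into [e j G]. *)
Variables (c H : P * R -> P) (HG : G * R -> G).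
Hypotheses (cc : continuous c) (c0 : forall p, c (p, 0) = p)
  (c1 : forall p, c (p, 1) = point) (cp : forall t, c (point, t) = point).
Hypotheses (cH : continuous H) (H0 : forall p, H (p, 0) = p)
  (Hp : forall t, 0 <= t <= 1 -> H (point, t) = point)
  (Hc : forall p t, H (c (p, t), 1) = c (H (p, 1), t)).
Hypotheses (cHG : continuous HG) (HG0 : forall g, HG (g, 0) = g)
  (HGp : forall t, 0 <= t <= 1 -> HG (point, t) = point).
Variables (d : nat -> P -> R) (e : nat -> G -> P) (kap : nat -> P -> G).
Hypotheses (cd : forall j, (j <= n)%N -> continuous (d j))
  (ce : forall j, (j <= n)%N -> continuous (e j))
  (ep : forall j, (j <= n)%N -> e j point = point)
  (de : forall j g, (j <= n)%N -> d j (e j g) = 0)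
  (He : forall j g t, (j <= n)%N -> 0 <= t <= 1 -> H (e j g, t) = e j (HG (g, t)))
  (ckap : forall j, (j <= n)%N -> {within [set p | d j p <= 1], continuous (kap j)})
  (ekap : forall j p, (j <= n)%N -> d j p <= 1 -> e j (kap j p) = H (p, 1))
  (kape : forall j g, (j <= n)%N -> kap j (e j g) = HG (g, 1)).
Variable iota : nat -> P -> F.
Hypotheses (ciota : forall k, (k <= n.+1)%N -> continuous (iota k))
  (iotap : forall k, (k <= n.+1)%N -> iota k point = point)
  (iotae : forall j g, (j <= n)%N -> iota j (e j g) = iota j.+1 (e j g))
  (iota_surj : forall x, exists2 k, (k <= n.+1)%N & exists p, x = iota k p).
(** The universal property of the union, required directly for [F * I] because homotopies are glued
    as well as maps. *)
Hypothesis glue : forall (T : topologicalType) (f : nat -> P * I -> T),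
  (forall k, (k <= n.+1)%N -> continuous (f k)) ->
  (forall j g s, (j <= n)%N -> f j (e j g, s) = f j.+1 (e j g, s)) ->
  exists h : F * I -> T, continuous h /\
    forall k p s, (k <= n.+1)%N -> h (iota k p, s) = f k (p, s).

Lemma exists_glued_map (T : topologicalType) (f : nat -> P -> T) :
  (forall k, (k <= n.+1)%N -> continuous (f k)) ->
  (forall j g, (j <= n)%N -> f j (e j g) = f j.+1 (e j g)) ->
  exists h : F -> T, continuous h /\
    forall k p, (k <= n.+1)%N -> h (iota k p) = f k p.
Proof.
move=> cf fe; have [||h [ch hE]] := @glue T (fun k p => f k p.1).
- by move=> k kn; apply: (cont_comp (cf k kn)); cont.
- by move=> j g s; exact: fe.
exists (fun x => h (x, zero)); split; last by move=> k p; exact: hE.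
by apply: (cont_comp ch); cont.
Qed.

Lemma kapp j : (j <= n)%N -> kap j point = point.
Proof. by move=> jn; rewrite -{1}(ep jn) kape // HGp // lexx ler01. Qed.

Lemma cont_c (T : topologicalType) (p : T -> P) (t : T -> R) :
  continuous p -> continuous t -> continuous (fun z => c (p z, t z)).
Proof. by move=> *; apply: (cont_comp cc); cont. Qed.

Lemma cont_H (T : topologicalType) (p : T -> P) (t : T -> R) :
  continuous p -> continuous t -> continuous (fun z => H (p z, t z)).
Proof. by move=> *; apply: (cont_comp cH); cont. Qed.

(* First contract along [phi], then run through the [j]-th suspension. *)
Definition collar (j : nat) (phi : P -> W) (p : P * R) : W :=
  if Num.max (d j p.1) p.2 <= 2^-1 then phi (c (p.1, 2 * Num.max (d j p.1) p.2))
  else if Num.max (d j p.1) p.2 <= 1 then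
    wedge_in n j (kap j p.1, 2 * Num.max (d j p.1) p.2 - 1)
  else point.

Lemma collar_continuous j phi : (j <= n)%N -> continuous phi ->
  phi point = point -> continuous (collar j phi).
Proof.
move=> jn cphi phip; rewrite /collar.
have cm : continuous (fun p : P * R => Num.max (d j p.1) p.2).
  by cont; apply: (cont_comp (cd jn)); cont.
apply: cont_if => //; first by cont.
- by apply: (cont_comp cphi); apply: cont_c; cont.
- apply: cont_within_if => //; first by cont.
  + apply: (within_comp (B := setT)); last by [].
      exact/within_continuous/wedge_in_continuous.
    apply: within_pair; last by apply: within_continuous; cont.
    apply: (within_comp (ckap jn)); first by apply: within_continuous; cont.
    by move=> z /=; rewrite ge_max => /andP[].
  + by apply: within_continuous; cont.
  + by move=> z ->; rewrite wedge_in_base //; right; right; lra.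
- move=> z ->; rewrite (_ : 2 * 2^-1 = 1); last by lra.
  rewrite c1 phip ifT; last by lra.
  by rewrite wedge_in_base //; right; left; lra.
Qed.

Lemma collar_point j phi v : (j <= n)%N -> phi point = point ->
  collar j phi (point, v) = point.
Proof.
move=> jn phip; rewrite /collar /= cp phip kapp //.
by rewrite wedge_in_base ?if_same //; left.
Qed.

Lemma collar_inner j phi g v : (j <= n)%N -> 0 <= v <= 2^-1 ->
  collar j phi (e j g, v) = phi (c (e j g, 2 * v)).
Proof. by move=> jn v01; rewrite /collar /= de // max_r ?ifT //; lra. Qed.

Lemma collar_outer j phi g v : (j <= n)%N -> phi point = point ->
  2^-1 <= v <= 1 -> collar j phi (e j g, v) = wedge_in n j (HG (g, 1), 2 * v - 1).
Proof.
move=> jn phip v01; rewrite /collar /= de // max_r; last by lra.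
rewrite kape //; have [v2|v2] := leP v 2^-1; last by rewrite ifT //; lra.
have -> : v = 2^-1 by lra.
rewrite (_ : 2 * 2^-1 = 1); last by lra.
by rewrite c1 phip wedge_in_base //; right; left; lra.
Qed.

Lemma collar_top j phi p : (j <= n)%N -> collar j phi (p, 1) = point.
Proof.
move=> jn; rewrite /collar /= ifF; last first.
  by apply/negbTE; rewrite -ltNge lt_max; apply/orP; right; lra.
case: ifP => // h; rewrite wedge_in_base //; right; right.
have : 1 <= Num.max (d j p) 1 by rewrite le_max lexx orbT.
by lra.
Qed.

(** The map to the wedge on copy [k]. As [d j] vanishes on the overlap, height 0 of the collar makes
    [pinch j.+1] agree there with [pinch j]. The second argument of [collar], here 0, is an
    additional height, which the homotopy from [Phi \o Psi] raises. *)
Fixpoint pinch (k : nat) : P -> W :=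
  if k is j.+1 then fun p => collar j (pinch j) (p, 0) else fun=> point.

Lemma pinch_point k : (k <= n.+1)%N -> pinch k point = point.
Proof.
by elim: k => // k IH kn; apply: collar_point; [exact: kn|exact/IH/ltnW].
Qed.

Lemma pinch_continuous k : (k <= n.+1)%N -> continuous (pinch k).
Proof.
elim: k => [_|k IH kn] /=; first by cont.
apply: (cont_comp (@collar_continuous _ _ _ _ _)) => //; last by cont.
- exact/IH/ltnW.
- exact/pinch_point/ltnW.
Qed.

Lemma pinch_e j g : (j <= n)%N -> pinch j (e j g) = pinch j.+1 (e j g).
Proof. by move=> jn; rewrite /= collar_inner ?mulr0 ?c0 //; lra. Qed.

Lemma exists_pinch : exists Phi : F -> W, continuous Phi /\
  forall k p, (k <= n.+1)%N -> Phi (iota k p) = pinch k p.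
Proof. by apply: exists_glued_map; [exact: pinch_continuous|exact: pinch_e]. Qed.

(* The two contractions of the [j]-th intersection form a suspension. *)
Definition double_cone (j : nat) (p : G * R) : F :=
  if p.2 <= 2^-1 then iota j (c (e j p.1, 1 - 2 * p.2))
  else iota j.+1 (c (e j p.1, 2 * p.2 - 1)).

Lemma double_cone_continuous j : (j <= n)%N -> continuous (double_cone j).
Proof.
move=> jn; apply: cont_if; cont.
- apply: (cont_comp (ciota (leqW jn))); apply: cont_c; cont.
  by apply: (cont_comp (ce jn)); cont.
- apply: (cont_comp (ciota (jn : (j.+1 <= n.+1)%N))); apply: cont_c; cont.
  by apply: (cont_comp (ce jn)); cont.
- move=> z ->; rewrite (_ : 2 * 2^-1 = 1); last by lra.
  by rewrite subrr !c0 iotae.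
Qed.

Lemma double_cone_base j g t : (j <= n)%N -> g = point \/ t = 0 \/ t = 1 ->
  double_cone j (g, t) = point.
Proof.
move=> jn; have jn' : (j <= n.+1)%N := leqW jn; rewrite /double_cone /=.
case=> [->|[->|->]].
- by rewrite ep // !cp !iotap // if_same.
- by rewrite ifT ?mulr0 ?subr0 ?c1 ?iotap //; lra.
- rewrite ifF; last by apply/negbTE; rewrite -ltNge; lra.
  by rewrite (_ : 2 * 1 - 1 = 1) ?c1 ?iotap //; lra.
Qed.

Lemma exists_double_cone : exists Psi : W -> F, continuous Psi /\
  forall j g t, (j <= n)%N -> 0 <= t <= 1 ->
    Psi (wedge_in n j (g, t)) = double_cone j (g, t).
Proof.
have [||K [cK KE]] := @wedge_elim_homotopy R G n F (fun j p => double_cone j p.1).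
- by move=> j jn; apply: (cont_comp (double_cone_continuous jn)); cont.
- by move=> j g t s jn h; exact: double_cone_base.
exists (fun w => K (w, zero)); split; first by apply: (cont_comp cK); cont.
move=> j g t jn t01; have := KE (inord j) g t zero t01.
by rewrite inordK.
Qed.

Lemma wedge_ptE j : wedge_in n j (point : G, 0 : R) = point.
Proof. by apply: wedge_in_base; left. Qed.

Section Equivalence.
Variables (Phi : F -> W) (Psi : W -> F).
Hypotheses (cPhi : continuous Phi) (cPsi : continuous Psi).
Hypothesis PhiE : forall k p, (k <= n.+1)%N -> Phi (iota k p) = pinch k p.
Hypothesis PsiE : forall j g t, (j <= n)%N -> 0 <= t <= 1 ->
  Psi (wedge_in n j (g, t)) = double_cone j (g, t).

Lemma Phip : Phi point = point.
Proof. by rewrite -(iotap (leq0n _)) PhiE. Qed.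

Lemma Psip : Psi point = point.
Proof.
rewrite -(wedge_ptE 0) PsiE ?lexx ?ler01 // double_cone_base //.
by left.
Qed.

(** At [l = 0] the point with coordinates [square_u] and [square_v] goes from [(0, 1/2)] to
    [(0, 0)], within copy [j], and on to [(1, 0)], within copy [j.+1]. Up to [l = 1/2] only [v]
    moves, later only [u]; so the end [t = 1] climbs the edge [u = 1] and then follows [v = 1],
    while the start stays at [(0, 1/2)], where the contraction is complete. *)
Definition square_u (t l : R) : R :=
  (1 - Num.max 0 (2 * l - 1)) * Num.max 0 (2 * t - 1).
Definition square_v (t l : R) : R :=
  (1 - Num.min (2 * l) 1) * Num.max 0 (2^-1 - t)
  + Num.min (2 * l) 1 * (2^-1 + t * 2^-1).

(* The path followed by [Phi \o Psi] in the square of coordinates (time of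
   contraction, height in the collar) slides to the straight segment of heights
   [1/2 <= v <= 1]; its endpoint stays on the collapsed edges [u = 1], [v = 1]. *)
Lemma Phi_Psi_homotopic1 : exists K : W * I -> W,
  [/\ continuous K, forall w, K (w, zero) = Phi (Psi w),
      forall j g t, (j <= n)%N -> 0 <= t <= 1 ->
        K (wedge_in n j (g, t), one) = wedge_in n j (HG (g, 1), t)
    & forall s, K (point, s) = point].
Proof.
have [||K [cK KE]] := @wedge_elim_homotopy R G n W (fun j p =>
   collar j (pinch j) (c (e j p.1.1, square_u p.1.2 (val p.2)),
                       square_v p.1.2 (val p.2))).
- move=> j jn; have jn' := leqW jn.
  apply: (cont_comp (collar_continuous jn (pinch_continuous jn') (pinch_point jn'))).
  rewrite /square_u /square_v; cont.
  apply: cont_c; cont.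
  by apply: (cont_comp (ce jn)); cont.
- move=> j g t s jn h; have jn' := leqW jn; have pp := pinch_point jn'.
  have : 0 <= sval s <= 1 := ui_bounds s.
  rewrite /=; move: (sval s) => l l01.
  case: h => [->|[->|->]]; first by rewrite ep // cp collar_point.
    rewrite /square_u /square_v (max_l (x := 0) (y := 2 * 0 - 1)); last by lra.
    rewrite (max_r (y := 2^-1 - 0)); last by lra.
    rewrite mulr0 c0; set m := Num.min _ 1.
    have -> : (1 - m) * (2^-1 - 0) + m * (2^-1 + 0 * 2^-1) = 2^-1 by ring.
    rewrite collar_inner //; last by lra.
    by rewrite (_ : 2 * 2^-1 = 1) ?c1 //; lra.
  rewrite /square_u /square_v (max_r (y := 2 * 1 - 1)); last by lra.
  rewrite (max_l (x := 0) (y := 2^-1 - 1)); last by lra.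
  have [l2|l2] := leP l 2^-1.
    rewrite (max_l (x := 0)); last by lra.
    by rewrite (_ : (1 - 0) * _ = 1) ?c1 ?collar_point //; lra.
  rewrite min_r; last by lra.
  by rewrite (_ : (1 - 1) * 0 + _ = 1) ?collar_top //; lra.
have KE' j g t s : (j <= n)%N -> 0 <= t <= 1 -> K (wedge_in n j (g, t), s) =
    collar j (pinch j) (c (e j g, square_u t (val s)), square_v t (val s)).
  by move=> jn t01; have := KE (inord j) g t s t01; rewrite inordK.
exists K; split => //.
- move=> w; have [j0 [g [t [t01 ->]]]] := wedge_in_surj w.
  have jn : (j0 <= n)%N by rewrite -ltnS.
  move: (nat_of_ord j0) jn => j jn; have jn' := leqW jn.
  rewrite KE' // PsiE // /double_cone /= /square_u /square_v.
  rewrite mulr0 (max_l (x := 0) (y := 0 - 1)); last by lra.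
  rewrite min_l; last by lra.
  rewrite subr0 !mul1r mul0r addr0.
  have [t2|t2] := leP t 2^-1.
    rewrite (max_l (x := 0)); last by lra.
    rewrite max_r; last by lra.
    rewrite c0 collar_inner //; last by lra.
    by rewrite PhiE //; congr (pinch _ (c (_, _))); lra.
  rewrite max_r; last by lra.
  by rewrite (max_l (x := 0)) ?PhiE //; lra.
- move=> j g t jn t01; rewrite KE' // /square_u /square_v /=.
  rewrite max_r; last by lra.
  rewrite min_r; last by lra.
  rewrite (_ : (1 - (2 * 1 - 1)) = 0); last by lra.
  rewrite mul0r c0 subrr mul0r add0r collar_outer //; last by lra.
    by congr (wedge_in _ _ (_, _)); lra.
  exact/pinch_point/leqW.
- move=> s; rewrite -(wedge_ptE 0) KE' ?lexx ?ler01 //.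
  by rewrite ep // cp collar_point // wedge_ptE.
Qed.

(** The first homotopy ends at the map induced on the suspensions by [HG] at time 1, and [HG] run
    backwards joins that map to the identity. *)
Lemma Phi_Psi_homotopic : pointed_homotopic R (Phi \o Psi) id.
Proof.
have [K [cK K0 K1 Kp]] := Phi_Psi_homotopic1.
apply: (@pointed_homotopic_trans _ _ _ _ (fun w => K (w, one))).
  by exists K; split.
have [||L [cL LE]] := @wedge_elim_homotopy R G n W (fun j p =>
   wedge_in n j (HG (p.1.1, 1 - val p.2), p.1.2)).
- move=> j jn; apply: (cont_comp (@wedge_in_continuous R G n j)); cont.
  by apply: (cont_comp cHG); cont.
- move=> j g t s jn h; rewrite wedge_in_base //=.
  case: h => [->|[->|->]]; [left|right; left|right; right] => //.
  by rewrite HGp //; have := ui_bounds s; rewrite /=; lra.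
have LE' j g t s : (j <= n)%N -> 0 <= t <= 1 -> L (wedge_in n j (g, t), s) =
    wedge_in n j (HG (g, 1 - val s), t).
  by move=> jn t01; have := LE (inord j) g t s t01; rewrite inordK.
exists L; split => //.
- move=> w; have [j [g [t [t01 ->]]]] := wedge_in_surj w.
  have jn : (j <= n)%N by rewrite -ltnS.
  by rewrite LE' // K1 //= subr0.
- move=> w; have [j [g [t [t01 ->]]]] := wedge_in_surj w.
  have jn : (j <= n)%N by rewrite -ltnS.
  by rewrite LE' //= subrr HG0.
- move=> s; rewrite -{1}(wedge_ptE 0) LE' ?lexx ?ler01 //.
  rewrite HGp ?wedge_ptE //.
  by have := ui_bounds s; lra.
Qed.


(* For [y] from [-1] to [1]: out of the base point within the copy [j], across
   the intersection at [y = 0], and back to the base point within [j.+1]. *)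
Definition crossing (j : nat) (p : P) (y : R) : F :=
  if 0 <= y then iota j.+1 (c (H (p, 1), y)) else iota j (c (H (p, 1), - y)).

Lemma crossing0 j p : (j <= n)%N -> d j p <= 1 ->
  iota j.+1 (H (p, 1)) = iota j (H (p, 1)).
Proof. by move=> jn dp1; rewrite -(ekap jn dp1) iotae. Qed.

Lemma crossing_le0 j p y : (j <= n)%N -> d j p <= 1 -> y <= 0 ->
  crossing j p y = iota j (c (H (p, 1), - y)).
Proof.
move=> jn dp1 y0; rewrite /crossing; have [y1|//] := leP 0 y.
have -> : y = 0 by lra.
by rewrite oppr0 c0 crossing0.
Qed.

(** Negative [y] uses copy [j], which joins copy [j.+1] along the overlap; [H (p, 1)] is known to
    lie there only when [d j p <= 1], so outside the halo [y] is kept nonnegative. *)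
Lemma crossing_continuous (T : topologicalType) j (p : T -> P) (y : T -> R) :
  (j <= n)%N -> continuous p -> continuous y ->
  (forall z, 1 <= d j (p z) -> 0 <= y z) ->
  continuous (fun z => crossing j (p z) (y z)).
Proof.
move=> jn cont_p cont_y dy.
have cdp : continuous (fun z => d j (p z)) by apply: (cont_comp (cd jn)).
have cA : continuous (fun z => iota j.+1 (c (H (p z, 1), y z))).
  apply: (cont_comp (ciota (jn : (j.+1 <= n.+1)%N))).
  by apply: cont_c => //; apply: cont_H => //; cont.
have cB : continuous (fun z => iota j (c (H (p z, 1), - y z))).
  apply: (cont_comp (ciota (leqW jn))).
  by apply: cont_c; [apply: cont_H => //; cont|cont].
have -> : (fun z => crossing j (p z) (y z)) = (fun z => if d j (p z) <= 1
    then crossing j (p z) (y z) else iota j.+1 (c (H (p z, 1), y z))).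
  apply/funext => z; case: ifPn => //; rewrite -ltNge => h.
  by rewrite /crossing dy //; exact: ltW.
apply: cont_within_if => //; first by cont.
- rewrite /crossing; apply: within_if => //; try exact: within_continuous.
  + by apply: closed_ler => //; cont.
  + by cont.
  + by move=> z /= dz y0; rewrite -y0 oppr0 !c0 crossing0.
- exact: within_continuous.
- by move=> z dz; rewrite /crossing dy // dz.
Qed.

(** For [x <= 1/2] this is minus the contraction time [2 x] of the collar; beyond, the suspension
    coordinate [2 x - 1] rescaled from [[0, 1]] to [[-1, 1]]. Both give -1 at [x = 1/2]. *)
Definition crossing_param (x : R) : R :=
  if x <= 2^-1 then - (2 * x) else Num.min (4 * x - 3) 1.

Lemma cont_crossing_param (T : topologicalType) (x : T -> R) :
  continuous x -> continuous (fun z => crossing_param (x z)).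
Proof.
move=> cx; apply: cont_if => //; cont.
by move=> z ->; rewrite min_l; lra.
Qed.

Definition Dmax (j : nat) (p : P) : R := Num.max (d j p) 0.

Lemma Dmax_ge0 j p : 0 <= Dmax j p.
Proof. by rewrite le_max lexx orbT. Qed.

Lemma Dmax_le1 j p : Dmax j p <= 1 -> d j p <= 1.
Proof. by rewrite ge_max => /andP[]. Qed.

Lemma Dmax_ge1 j p : 1 <= d j p -> 1 <= Dmax j p.
Proof. by move=> h; rewrite le_max h. Qed.

Lemma Dmax_e j g : (j <= n)%N -> Dmax j (e j g) = 0.
Proof. by move=> jn; rewrite /Dmax de // max_r. Qed.

Lemma cont_Dmax (T : topologicalType) j (p : T -> P) : (j <= n)%N ->
  continuous p -> continuous (fun z => Dmax j (p z)).
Proof. by move=> jn ?; rewrite /Dmax; cont; apply: (cont_comp (cd jn)). Qed.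

(** In the inner part of the collar [pinch j.+1] is [pinch j] after a contraction, so the homotopy
    [D] found on copy [j] applies there; the rest stands still. [phase2] then pulls the whole
    crossing back to [y = 0]. *)
Definition phase1 (j : nat) (D : P * R -> F) (q : P * R) : F :=
  if Dmax j q.1 <= 2^-1 then D (c (q.1, 2 * Dmax j q.1), q.2)
  else crossing j q.1 (Num.min (4 * Dmax j q.1 - 3) 1).

Definition phase2 (j : nat) (q : P * R) : F :=
  crossing j q.1 (Num.max 0 (1 - q.2) * crossing_param (Dmax j q.1)).

Section Phases.
Variables (j : nat) (D : P * R -> F).
Hypotheses (jn : (j <= n)%N) (cD : continuous D)
  (D0 : forall p, D (p, 0) = Psi (pinch j p))
  (D1 : forall p, D (p, 1) = iota j (H (p, 1)))
  (Dpt : forall s, D (point, s) = point).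

Lemma phase1_continuous : continuous (phase1 j D).
Proof.
have cx : continuous (fun q : P * R => Dmax j q.1) by apply: cont_Dmax => //; cont.
apply: cont_if => //; first by cont.
- by apply: (cont_comp cD); cont; apply: cont_c; cont.
- apply: crossing_continuous => //; cont.
  by move=> z /Dmax_ge1 h; rewrite le_min; apply/andP; split; lra.
- move=> z h; rewrite h (_ : 2 * 2^-1 = 1); last by lra.
  rewrite c1 Dpt min_l; last by lra.
  rewrite crossing_le0 //; last by lra.
    have -> : - (4 * 2^-1 - 3) = 1 :> R by lra.
    by rewrite c1 iotap // leqW.
  by apply: Dmax_le1; lra.
Qed.

Lemma phase2_continuous : continuous (phase2 j).
Proof.
have cx : continuous (fun q : P * R => Dmax j q.1) by apply: cont_Dmax => //; cont.
apply: crossing_continuous => //; cont; first exact: cont_crossing_param.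
move=> z /Dmax_ge1 h; apply: mulr_ge0; first by rewrite le_max lexx.
rewrite /crossing_param ifF; last by apply/negbTE; rewrite -ltNge; lra.
by rewrite le_min; apply/andP; split; lra.
Qed.

Lemma phase1_0 p : phase1 j D (p, 0) = Psi (pinch j.+1 p).
Proof.
rewrite /phase1 /= /collar /= -/(Dmax j p); have := Dmax_ge0 j p => x0.
case: ifPn => [_|]; rewrite ?D0 // -ltNge => x2.
have [x1|x1] := leP (Dmax j p) 1; last first.
  rewrite Psip min_r; last by lra.
  by rewrite /crossing ler01 c1 iotap.
have dp1 := Dmax_le1 x1.
rewrite min_l; last by lra.
rewrite PsiE //; last by lra.
rewrite /double_cone /= ekap //.
have [x3|x3] := leP (2 * Dmax j p - 1) 2^-1.
  rewrite crossing_le0 //; last by lra.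
  by congr (iota _ (c (_, _))); lra.
rewrite /crossing ifT; last by lra.
by congr (iota _ (c (_, _))); lra.
Qed.

Lemma phase1_1 p : phase1 j D (p, 1) = phase2 j (p, 0).
Proof.
rewrite /phase1 /phase2 /= subr0 max_r ?ler01 // mul1r /crossing_param.
have x0 := Dmax_ge0 j p; case: ifP => // x2.
rewrite D1 Hc crossing_le0 ?opprK //; last by lra.
by apply: Dmax_le1; lra.
Qed.

Lemma phase2_1 p : phase2 j (p, 1) = iota j.+1 (H (p, 1)).
Proof.
by rewrite /phase2 /= subrr max_l // mul0r /crossing lexx c0.
Qed.

Lemma phase1_e g s : phase1 j D (e j g, s) = D (e j g, s).
Proof. by rewrite /phase1 /= Dmax_e // mulr0 c0 ifT //; lra. Qed.

Lemma phase2_e g s : phase2 j (e j g, s) = D (e j g, 1).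
Proof.
rewrite /phase2 /= Dmax_e // /crossing_param ifT; last by lra.
by rewrite mulr0 oppr0 mulr0 /crossing lexx c0 D1 crossing0 // de // ler01.
Qed.

Lemma phase1_pt s : phase1 j D (point, s) = point.
Proof. by rewrite -(ep jn) phase1_e ep. Qed.

Lemma phase2_pt s : phase2 j (point, s) = point.
Proof. by rewrite -{1}(ep jn) phase2_e ep. Qed.

End Phases.

(** Adding a copy runs the homotopies already found at double speed and then stops them, while the
    new copy goes through [phase1] and [phase2]. These match, since on the overlap [phase1] is [D]
    and [phase2] is stationary. *)
Lemma exists_unpinching K : (K <= n.+1)%N -> exists D : nat -> P * R -> F,
  (forall k, (k <= K)%N -> [/\ continuous (D k),
     forall p, D k (p, 0) = Psi (pinch k p),
     forall p, D k (p, 1) = iota k (H (p, 1))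
   & forall s, D k (point, s) = point]) /\
  (forall j g s, (j < K)%N -> D j (e j g, s) = D j.+1 (e j g, s)).
Proof.
elim: K => [_|K IH Kn].
  (* On copy 0 the composite is constant; the contraction run backwards leads from the base point to
     [H (p, 1)]. *)
  exists (fun _ q => iota 0 (c (H (q.1, 1), 1 - q.2))); split => //.
  case=> // _; split.
  - apply: (cont_comp (ciota _)) => //; apply: cont_c; cont.
    by apply: cont_H; cont.
  - by move=> p; rewrite /= subr0 c1 iotap // Psip.
  - by move=> p; rewrite /= subrr c0.
  - by move=> s; rewrite /= Hp ?cp ?iotap // lexx ler01.
have [D [DP De]] := IH (ltnW Kn).
have [cD D0 D1 Dpt] := DP K (leqnn K).
pose last_D (q : P * R) := if q.2 <= 2^-1 then phase1 K (D K) (q.1, 2 * q.2)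
  else phase2 K (q.1, 2 * q.2 - 1).
exists (fun k q => if (k <= K)%N then D k (q.1, Num.min (2 * q.2) 1) else last_D q).
split=> [k|j g s]; last first.
  rewrite ltnS [X in is_true X -> _]leq_eqVlt => /orP[/eqP ->|jK]; last first.
    by rewrite (ltnW jK) jK De.
  rewrite leqnn ltnn /last_D /=; have [s2|s2] := leP s 2^-1.
    by rewrite phase1_e // min_l //; lra.
  by rewrite (phase2_e Kn D1) min_r //; lra.
rewrite [X in is_true X -> _]leq_eqVlt => /orP[/eqP ->|]; last first.
  rewrite ltnS => kK; rewrite kK; have [ck k0 k1 kpt] := DP k kK; split => //.
  - by apply: (cont_comp ck); cont.
  - by move=> p; rewrite /= mulr0 min_l ?ler01.
  - by move=> p; rewrite /= mulr1 min_r //; lra.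
rewrite ltnn /last_D; split.
- apply: cont_if; cont.
  + by apply: (cont_comp (phase1_continuous Kn cD Dpt)); cont.
  + by apply: (cont_comp (phase2_continuous Kn)); cont.
  + move=> z ->; rewrite (_ : 2 * 2^-1 = 1); last by lra.
    by rewrite subrr (phase1_1 Kn D1).
- move=> p; rewrite /= ifT; last by lra.
  by rewrite mulr0 (phase1_0 Kn D0).
- move=> p; rewrite /= ifF; last by apply/negbTE; rewrite -ltNge; lra.
  by rewrite (_ : 2 * 1 - 1 = 1) ?phase2_1 //; lra.
- move=> s; rewrite /=; case: ifP => _; first exact: phase1_pt.
  by rewrite (phase2_pt Kn D1).
Qed.

Lemma Psi_Phi_homotopic : pointed_homotopic R (Psi \o Phi) id.
Proof.
have [D [DP De]] := exists_unpinching (leqnn n.+1).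
have [||K1 [cK1 K1E]] := @glue F (fun k q => D k (q.1, val q.2)).
- by move=> k kn; have [cDk _ _ _] := DP k kn; apply: (cont_comp cDk); cont.
- by move=> j g s jn; exact: De.
have [||K2 [cK2 K2E]] := @glue F (fun k q => iota k (H (q.1, 1 - val q.2))).
- by move=> k kn; apply: (cont_comp (ciota kn)); apply: cont_H; cont.
- move=> j g s jn; rewrite /= He ?iotae //.
  by have : 0 <= sval s <= 1 := ui_bounds s; lra.
have pt0 : point = iota 0 point by rewrite iotap.
apply: (@pointed_homotopic_trans _ _ _ _ (fun x => K1 (x, one))).
  exists K1; split => //.
  - move=> x; have [k kn [p ->]] := iota_surj x; have [_ Dk0 _ _] := DP k kn.
    by rewrite K1E //= Dk0 PhiE.
  - by move=> s; rewrite {1}pt0 K1E //=; have [_ _ _ ->] := DP 0%N isT.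
exists K2; split => //.
- move=> x; have [k kn [p ->]] := iota_surj x; have [_ _ Dk1 _] := DP k kn.
  by rewrite K1E // K2E //= Dk1 subr0.
- by move=> x; have [k kn [p ->]] := iota_surj x; rewrite K2E //= subrr H0.
- move=> s; rewrite {1}pt0 K2E //= Hp ?iotap //.
  by have : 0 <= sval s <= 1 := ui_bounds s; lra.
Qed.

End Equivalence.

Theorem glued_contractibles : homotopy_equivalent R F W.
Proof.
have [Phi [cPhi PhiE]] := exists_pinch.
have [Psi [cPsi PsiE]] := exists_double_cone.
exists (PointedMap cPhi (Phip PhiE)), (PointedMap cPsi (Psip PsiE)).
by split; [exact: Psi_Phi_homotopic|exact: Phi_Psi_homotopic].
Qed.

End GluedContractibles.

(** * The iterated gluing as a chain of copies *)

Section PushoutVertices.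
Variables (U V W : finType) (L : scomplex U) (a : U -> V) (b : U -> W).
Local Notation inlP := (pushout_inl L a b).
Local Notation inrP := (pushout_inr L a b).

Lemma glue_connect_invariant (T : eqType) (f : V + W -> T) :
  (forall u, u \in vertices L -> f (inl (a u)) = f (inr (b u))) ->
  forall x y, connect (glue_edge L a b) x y -> f x = f y.
Proof.
move=> fab x y xy.
have cl : fingraph.closed (glue_edge L a b) [pred z | f z == f x].
  move=> z z' /exists_inP[u uL] /orP[]/andP[/eqP -> /eqP ->];
  by rewrite !inE fab.
by have := closed_connect cl xy; rewrite !inE eqxx => /esym/eqP.
Qed.

Lemma pushout_classP x y :
  reflect (connect (glue_edge L a b) x y)
    (pushout_class L a b x == pushout_class L a b y).
Proof.
by apply: (iffP eqP) => [[/eqP]|h];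
  [rewrite root_connect //; exact: glue_edge_sym
  |apply: val_inj; apply/eqP; rewrite /= root_connect //; exact: glue_edge_sym].
Qed.

Lemma pushout_glued u : u \in vertices L -> inlP (a u) = inrP (b u).
Proof.
move=> uL; apply/eqP/pushout_classP/connect1.
by apply/exists_inP; exists u; rewrite // !eqxx.
Qed.

(** The map [f] sends a glued vertex of [W] back to its partner in [V], unambiguous as [b] is
    injective; it is constant on classes and the identity on [V]. *)
Lemma pushout_inl_inj : injective b -> injective inlP.
Proof.
move=> bI v v' /eqP/pushout_classP h.
pose f (x : V + W) : V + W := match x with
  | inl v => inl v
  | inr w => if [pick u in vertices L | b u == w] is Some u then inl (a u)
             else inr w
  end.
have fab u : u \in vertices L -> f (inl (a u)) = f (inr (b u)).
  move=> uL /=; case: pickP => [u' /andP[_ /eqP/bI -> //]|/(_ u)].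
  by rewrite uL eqxx.
by have := glue_connect_invariant fab h; case.
Qed.

(** The universal property of the pushout on vertices, by which the fold extends over a new copy. *)
Lemma pushout_retract (T : eqType) (f : V -> T) (g : W -> T) :
  (forall u, u \in vertices L -> f (a u) = g (b u)) ->
  exists h : pushout_vertex L a b -> T,
    (forall v, h (inlP v) = f v) /\ (forall w, h (inrP w) = g w).
Proof.
move=> fg; pose fg' (x : V + W) := match x with inl v => f v | inr w => g w end.
have inv := @glue_connect_invariant T fg' fg.
exists (fun x => fg' (val x)); split=> v; rewrite /= -(inv _ _ (connect_root _ _)) //.
Qed.

End PushoutVertices.

Section SimplicialIso.
Variable V : finType.
Implicit Types (s t : {perm V}) (K : scomplex V).

Lemma imset_permM s t (A : {set V}) : ((s * t)%g @: A = t @: (s @: A))%SET.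
Proof. by rewrite -imset_comp; apply: eq_imset => x; rewrite permM. Qed.

Lemma imset_permK s (A : {set V}) : (s^-1%g @: (s @: A) = A)%SET.
Proof.
by rewrite -imset_permM mulgV -[RHS]imset_id; apply: eq_imset => x; rewrite perm1.
Qed.

Lemma imset_permKV s (A : {set V}) : (s @: (s^-1%g @: A) = A)%SET.
Proof. by rewrite -{1}(invgK s) imset_permK. Qed.

Lemma simplicial_isoV s K K' : simplicial_iso s K K' -> simplicial_iso s^-1%g K' K.
Proof. by move=> h A; rewrite -h imset_permKV. Qed.

Lemma simplicial_isoM s t K K' K'' : simplicial_iso s K K' ->
  simplicial_iso t K' K'' -> simplicial_iso (s * t)%g K K''.
Proof. by move=> hs ht A; rewrite imset_permM ht hs. Qed.

Lemma simplicial_iso1 K : simplicial_iso 1%g K K.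
Proof.
move=> A; rewrite (_ : (1%g : {perm V}) @: A = A)%SET // -[RHS]imset_id.
by apply: eq_imset => x; rewrite perm1.
Qed.

Lemma simplicial_isoX s K k : simplicial_iso s K K -> simplicial_iso (s ^+ k)%g K K.
Proof.
move=> h; elim: k => [|k IH]; first exact: simplicial_iso1.
by rewrite expgS; exact: simplicial_isoM h IH.
Qed.

End SimplicialIso.

(* [M] is covered by [N] copies [g i] of [K1], on which [rho] is a common left
   inverse; consecutive copies meet along the image of [Lam i]. *)
Record chain_of_copies (m : nat) (V : finType) (M : scomplex V)
    (K1 : scomplex 'I_m) (Lam : nat -> scomplex 'I_m) (N : nat)
    (rho : V -> 'I_m) (g : nat -> 'I_m -> V) : Prop := ChainOfCopies {
  chain_retract : forall i v, (i < N)%N -> rho (g i v) = v;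
  chain_faces : forall t : {set V}, t \in faces M <->
    exists i, (i < N)%N /\ exists2 s : {set 'I_m}, s \in faces K1 & t = (g i @: s)%SET;
  chain_glued : forall i v, (i.+1 < N)%N -> v \in vertices (Lam i) ->
    g i v = g i.+1 v;
  chain_meet : forall i j (s s' : {set 'I_m}), (i < j)%N -> (j < N)%N ->
    s \in faces K1 -> s' \in faces K1 -> (g i @: s = g j @: s')%SET ->
    s' \in faces (Lam j.-1)
}.

(** * The fold of the iterated gluing *)

Section Chain.
Variables (m : nat) (K : nat -> scomplex 'I_m).
Variables (phi : nat -> nat -> {perm 'I_m}) (psi : {perm 'I_m}).
Variables (L2 : scomplex 'I_m) (n : nat).
Hypothesis hphi : forall i j : nat, (1 <= i)%N -> (i < j)%N -> (j <= n)%N ->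
  simplicial_iso (phi i j) (K i) (K j).
Hypothesis hpsi : simplicial_iso psi (K 1%N) (K 1%N).
Hypothesis hglue : gluing_condition K phi psi L2 n.

Definition twist (i : nat) : {perm 'I_m} := (psi^-1 ^+ i)%g.

Definition twisted (i : nat) : scomplex 'I_m := image_complex (twist i) L2.

Lemma twist_iso i : simplicial_iso (twist i) (K 1%N) (K 1%N).
Proof. exact/simplicial_isoX/simplicial_isoV. Qed.

Lemma twistS i v : twist i.+1 (psi v) = twist i v.
Proof. by rewrite /twist expgS permM permK. Qed.

Lemma phi1_iso k : (0 < k <= n)%N -> simplicial_iso (phi1 phi k) (K 1%N) (K k).
Proof.
rewrite /phi1; have [->|k1 /andP[k0 kn]] := eqVneq k 1%N.
  by move=> _; exact: simplicial_iso1.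
by apply: hphi => //; case: k k1 k0 {kn} => [|[]].
Qed.

(** The conclusion on [stage_emb] serves the induction: it expresses through [g k] the copy along
    which the next complex is glued. *)
Lemma iterated_gluing_chain k : (k < n)%N ->
  exists (rho : stage_vertex (iterated_gluing K phi psi L2 k.+1) -> 'I_m)
         (g : nat -> 'I_m -> stage_vertex (iterated_gluing K phi psi L2 k.+1)),
    chain_of_copies (stage_complex (iterated_gluing K phi psi L2 k.+1))
      (K 1%N) twisted k.+1 rho g /\
    forall v, stage_emb (iterated_gluing K phi psi L2 k.+1) (phi1 phi k.+1 v) =
      g k (twist k v).
Proof.
elim: k => [_|k IH kn].
  exists id, (fun _ => id); split; last first.
    by move=> v; rewrite /= /phi1 /twist eqxx expg0 !perm1.
  split => //=.
  - move=> t; split=> [tK|[i [_ [s sK ->]]]]; last by rewrite imset_id.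
    by exists 0%N; split => //; exists t; rewrite ?imset_id.
  - by move=> i j s s' ij; rewrite ltnS leqn0 => /eqP j0; rewrite j0 in ij.
have [rho [g [[rg fM gg gm] eg]]] := IH (ltnW kn).
set S := iterated_gluing K phi psi L2 k.+1 in rho g rg fM gg gm eg *.
have -> : iterated_gluing K phi psi L2 k.+2 = glue_step K phi psi L2 k.+1 S by [].
pose L := glue_locus phi L2 k.+1; pose a := stage_emb S.
pose b := glue_map phi psi k.+1.
pose inlP := pushout_inl L a b; pose inrP := pushout_inr L a b.
have bI : injective b by move=> v v' /perm_inj/perm_inj/perm_inj.
have aE v : a v = g k (twist k ((phi1 phi k.+1)^-1%g v)).
  by rewrite -eg permKV.
have [|rho' [rhol rhor]] := @pushout_retract _ _ _ L a b _ rho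
    (fun w => twist k.+1 ((phi1 phi k.+2)^-1%g w)).
  by move=> u _; rewrite aE rg // /b /glue_map permK twistS.
(* The new copy is parametrized by the inverse of its fold, which makes [rho'] a left inverse. *)
pose g' i v := if (i < k.+1)%N then inlP (g i v)
  else inrP (phi1 phi k.+2 ((twist k.+1)^-1%g v)).
exists rho', g'; split; last first.
  by move=> v; rewrite /= /g' ltnn permK.
have g'l i (s : {set 'I_m}) : (i < k.+1)%N -> (g' i @: s = inlP @: (g i @: s))%SET.
  by move=> ik; rewrite -imset_comp; apply: eq_imset => v; rewrite /g' ik.
have g'r (s : {set 'I_m}) : (g' k.+1 @: s =
    inrP @: (phi1 phi k.+2 @: ((twist k.+1)^-1%g @: s)))%SET.
  by rewrite -!imset_comp; apply: eq_imset => v; rewrite /g' ltnn.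
have rg' i v : (i < k.+2)%N -> rho' (g' i v) = v.
  rewrite ltnS leq_eqVlt /g' => /orP[/eqP ->|ik].
    by rewrite ltnn rhor permK permKV.
  by rewrite ik rhol rg.
have rgS i (s : {set 'I_m}) : (i < k.+2)%N -> (rho' @: (g' i @: s) = s)%SET.
  move=> ik; rewrite -imset_comp -[RHS]imset_id.
  by apply: eq_imset => v; exact: rg'.
have isoK (s : {set 'I_m}) :
    (phi1 phi k.+2 @: ((twist k.+1)^-1%g @: s) \in faces (K k.+2))%SET =
    (s \in faces (K 1%N)).
  by rewrite phi1_iso //; exact: simplicial_isoV (twist_iso _) _.
have gg' i v : (i.+1 < k.+2)%N -> v \in vertices (twisted i) -> g' i v = g' i.+1 v.
  rewrite ltnS leq_eqVlt => /orP[/eqP[->]|ik].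
    rewrite inE => /imsetP[s sL vs].
    have : v \in (twist k @: s)%SET by rewrite -vs inE.
    case/imsetP => u us ->.
    have uL : u \in vertices L2.
      by rewrite inE; apply: facesS sL; rewrite finset.sub1set.
    have -> : g' k.+1 (twist k u) = inrP (phi1 phi k.+2 (psi u)).
      by rewrite /g' ltnn -twistS permK.
    have -> : g' k (twist k u) = inlP (g k (twist k u)) by rewrite /g' ltnSn.
    have /(@pushout_glued _ _ _ L a b) : phi1 phi k.+1 u \in vertices L.
      rewrite inE; apply/imsetP; exists [set u]%SET; last by rewrite imset_set1.
      by move: uL; rewrite inE.
    have -> : a (phi1 phi k.+1 u) = g k (twist k u) by rewrite aE permK.
    by have -> : b (phi1 phi k.+1 u) = phi1 phi k.+2 (psi u) by rewrite /b /glue_map permK.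
  by move=> vL; rewrite /g' ik (ltnW ik) gg.
split => //.
- move=> t; rewrite inE; split.
    case/orP => /imsetP[t' t'M ->].
      have [i [ik [s sK ->]]] := (fM t').1 t'M.
      exists i; split; first exact: leqW.
      by exists s => //; rewrite g'l.
    exists k.+1; split => //.
    exists (twist k.+1 @: ((phi1 phi k.+2)^-1%g @: t'))%SET.
      by rewrite -isoK imset_permK imset_permKV.
    by rewrite g'r imset_permK imset_permKV.
  case=> i [ik [s sK ->]]; move: ik; rewrite ltnS leq_eqVlt => /orP[/eqP ->|ik].
    apply/orP; right; rewrite g'r; apply/imsetP.
    by exists (phi1 phi k.+2 @: ((twist k.+1)^-1%g @: s))%SET; rewrite ?isoK.
  apply/orP; left; rewrite g'l //; apply/imsetP; exists (g i @: s)%SET => //.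
  by apply/fM; exists i; split => //; exists s.
- move=> i j s s' ij; rewrite ltnS leq_eqVlt => /orP[/eqP jk|jk] sK s'K E.
    have ik : (i < k.+1)%N by rewrite -jk.
    (* A face common to an earlier copy and the new one lies on both sides of the pushout, so by the
       gluing condition it is the image of a face [w] of [L2]. That image lies in copy [k], and
       folding shows that [s'] is the twist of [w]. *)
    have : (g' i @: s)%SET \in (faces (image_complex inlP (stage_complex S))
        :&: faces (image_complex inrP (K k.+2)))%SET.
      rewrite inE; apply/andP; split.
        rewrite g'l //; apply/imsetP; exists (g i @: s)%SET => //.
        by apply/fM; exists i; split => //; exists s.
      rewrite E jk g'r; apply/imsetP.
      by exists (phi1 phi k.+2 @: ((twist k.+1)^-1%g @: s'))%SET; rewrite ?isoK.
    have -> := hglue (k := k.+1) kn.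
    case/imsetP => _ /imsetP[w wL2 ->] E'.
    have E'' : (g' i @: s = g' k @: (twist k @: w))%SET.
      rewrite E' g'l // -!imset_comp; apply: eq_imset => v.
      rewrite -[LHS]/(inlP (a (phi1 phi k.+1 v))) -[RHS]/(inlP (g k (twist k v))).
      by rewrite aE permK.
    apply/imsetP; exists w => //; rewrite jk /=.
    by rewrite -(rgS j s') ?jk // -jk -E E'' rgS // ltnW.
  have ik := ltn_trans ij jk.
  apply: (gm i j s s') => //; move: E; rewrite !g'l //.
  exact: (imset_inj (pushout_inl_inj bI)).
Qed.

End Chain.

(** * Polyhedral powers *)

Section PolyhedralPowers.
Variable X : ptopologicalType.

Definition supp (V : finType) (x : V -> X) : {set V} := [set v | x v != point]%SET.

Lemma polyhedral_productP (V : finType) (K : scomplex V) (x : {ptws V -> X}) :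
  polyhedral_product [set (point : X)] K x <-> supp x \in faces K.
Proof.
split=> [[s /= sK xs]|xK].
  apply: facesS sK; apply/fintype.subsetP => v; rewrite inE; apply: contraR => vs.
  by have := xs v; rewrite (negbTE vs) => ->.
exists (supp x) => //= v; case: ifPn => // ; rewrite inE negbK => /eqP.
exact.
Qed.

Definition coord (V : finType) (K : scomplex V) (b : polyhedral_power X K) : V -> X :=
  val b.

Lemma coord_face (V : finType) (K : scomplex V) (b : polyhedral_power X K) :
  supp (coord b) \in faces K.
Proof. by apply/polyhedral_productP; exact: set_valP. Qed.

Lemma coordP (V : finType) (K : scomplex V) (b b' : polyhedral_power X K) :
  (forall v, coord b v = coord b' v) -> b = b'.
Proof. by move=> h; apply: val_inj; apply/funext. Qed.

Lemma cont_coord (V : finType) (K : scomplex V) (T : topologicalType)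
    (b : T -> polyhedral_power X K) (v : V) :
  continuous b -> continuous (fun z => coord (b z) v).
Proof.
move=> cb.
apply: (@cont_comp T {ptws V -> X} X (fun f => f v) (fun z => val (b z))).
  exact: (@proj_continuous V (fun=> X) v).
by apply: (cont_comp _ cb); exact: initial_continuous.
Qed.

Section PowerMap.
Variables (V : finType) (K : scomplex V) (T : topologicalType) (a : T -> V -> X).
Hypotheses (ca : forall v, continuous (a^~ v)) (aK : forall z, supp (a z) \in faces K).

Lemma power_map_proof z : (a z : {ptws V -> X}) \in polyhedral_product [set point] K.
Proof. by rewrite inE; exact/polyhedral_productP. Qed.

Definition power_map (z : T) : polyhedral_power X K :=
  exist (fun x => x \in polyhedral_product [set (point : X)] K) _ (power_map_proof z).

Lemma coord_power_map z v : coord (power_map z) v = a z v.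
Proof. by []. Qed.

Lemma power_map_continuous : continuous power_map.
Proof.
apply: continuous_comp_initial.
have ctop : continuous (a : T -> {ptws V -> X}); last exact: ctop.
move=> z; apply/cvg_sup.
move=> v; move: z; apply/(@continuousP _ (initial_topology (@^~ v))) => A [B oB <-].
exact: (continuousP _).1 (@ca v) B oB.
Qed.

End PowerMap.
End PolyhedralPowers.

(** * The fold on polyhedral powers and its sections *)

Section RetractionOntoCopy.
Variables (X : ptopologicalType) (V : finType) (M : scomplex V) (m n : nat).
Variables (K1 : scomplex 'I_m) (Lam : nat -> scomplex 'I_m).
Variables (rho : V -> 'I_m) (g : nat -> 'I_m -> V).
Hypothesis hg : chain_of_copies M K1 Lam n.+2 rho g.
Hypothesis clpt : closed [set (point : X)].
Local Notation Y := (polyhedral_power X M).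
Local Notation B := (polyhedral_power X K1).

Lemma g_inj i : (i < n.+2)%N -> injective (g i).
Proof. by move=> iN; apply: can_inj (rho) _ => v; exact: chain_retract hg _ _ iN. Qed.

Definition piece (i : nat) : set Y :=
  [set y | exists2 s : {set 'I_m}, s \in faces K1 & supp (coord y) = (g i @: s)%SET].

Lemma piece_cover (y : Y) : exists i : 'I_n.+2, piece i y.
Proof.
have [i [iN [s sK sE]]] := (chain_faces hg _).1 (coord_face y).
by exists (Ordinal iN), s.
Qed.

(** Faces being closed under subsets, a piece is the finite union, over the faces, of the closed
    sets where all coordinates off the face are the base point. *)
Lemma piece_closed i : (i < n.+2)%N -> closed (piece i).
Proof.
move=> iN; pose Z (s : {set 'I_m}) :=
  [set y : Y | forall v, v \notin (g i @: s)%SET -> coord y v = point].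
have -> : piece i = \bigcup_(s in [set s : {set 'I_m} | s \in faces K1]) Z s.
  apply/seteqP; split=> y [s sK ys].
    by exists s => // v; rewrite -ys inE negbK => /eqP.
  exists (g i @^-1: supp (coord y))%SET.
    apply: facesS sK; apply/fintype.subsetP => w; rewrite !inE.
    by apply: contraR => ws; rewrite ys // (mem_imset _ _ (g_inj iN)).
  apply/setP => v; apply/idP/imsetP => [vy|[w + ->]]; last by rewrite inE.
  have /imsetP[w ws vw] : v \in (g i @: s)%SET.
    by apply: contraLR vy => vs; rewrite inE ys // eqxx.
  by exists w => //; rewrite inE -vw.
apply: closed_bigcup => [|s _]; first exact: finite_finset.
have -> : Z s = \bigcap_(v in [set v | v \notin (g i @: s)%SET])
    [set y | coord y v = point].
  by apply/seteqP; split.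
apply: closed_bigI => v _.
have cv : continuous (fun y : Y => coord y v) by apply: cont_coord; cont.
exact: (continuous_closedP _).1 cv _ clpt.
Qed.

Definition retr_coord (y : Y) (w : 'I_m) : X :=
  if [pick i : 'I_n.+2 | coord y (g i w) != point] is Some i then coord y (g i w)
  else point.

(** If [g j w] is in the support it lies in copy [i], hence is some [g i w'], and [rho] gives
    [w' = w]: it does not matter which copy is picked. *)
Lemma retr_coordE i y w : (i < n.+2)%N -> piece i y ->
  retr_coord y w = coord y (g i w).
Proof.
move=> iN [s sK ys]; rewrite /retr_coord; case: pickP => [j jw|no]; last first.
  by have /negbFE/eqP -> := no (Ordinal iN).
suff -> : g j w = g i w by [].
have /imsetP[w' _ E] : g j w \in (g i @: s)%SET by rewrite -ys inE.
rewrite E; congr (g i _).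
by rewrite -(chain_retract hg w (ltn_ord j)) E (chain_retract hg).
Qed.

Lemma supp_retr i (y : Y) (s : {set 'I_m}) : (i < n.+2)%N -> s \in faces K1 ->
  supp (coord y) = (g i @: s)%SET -> supp (retr_coord y) = s.
Proof.
move=> iN sK ys; apply/setP => w; rewrite inE (@retr_coordE i) //; last by exists s.
rewrite -(mem_imset s w (g_inj iN)) -ys inE //.
Qed.

Lemma retr_coord_continuous w : continuous (retr_coord^~ w).
Proof.
apply: (@cont_finite_cover _ _ _ (fun i : 'I_n.+2 => piece i)).
- by move=> i; exact: piece_closed.
- exact: piece_cover.
- move=> i; apply: (@eq_within _ _ _ (fun y => coord y (g i w))).
    by move=> y yi; rewrite (retr_coordE w (ltn_ord i) yi).
  by apply: within_continuous; apply: cont_coord; cont.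
Qed.

Lemma retr_coord_face y : supp (retr_coord y) \in faces K1.
Proof. by have [i [s sK ys]] := piece_cover y; rewrite (supp_retr _ sK ys). Qed.

Lemma retr_point : power_map retr_coord_face point = point.
Proof.
apply: coordP => w; rewrite coord_power_map; have [i pi] := piece_cover point.
by rewrite (retr_coordE w (ltn_ord i) pi).
Qed.

Definition retr : pointed_map Y B :=
  PointedMap (power_map_continuous (aK := retr_coord_face) retr_coord_continuous)
    retr_point.

Lemma coord_retr i y w : (i < n.+2)%N -> piece i y ->
  coord (retr y) w = coord y (g i w).
Proof. exact: retr_coordE. Qed.

(** The test decides whether [v] lies in copy [i]; off that copy the section is the base point. *)
Definition sect_coord (i : nat) (b : B) (v : V) : X :=
  if g i (rho v) == v then coord b (rho v) else point.

Lemma supp_sect i b : (i < n.+2)%N ->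
  supp (sect_coord i b) = (g i @: supp (coord b))%SET.
Proof.
move=> iN; apply/setP => v; rewrite inE /sect_coord.
case: (g i (rho v) =P v) => [E|nE].
  by rewrite -{2}E (mem_imset _ _ (g_inj iN)) inE.
rewrite eqxx; apply/esym/negbTE/negP => /imsetP[w _ vE]; apply: nE.
by rewrite vE (chain_retract hg).
Qed.

Lemma sect_continuous i v : continuous ((sect_coord i)^~ v).
Proof.
rewrite /sect_coord; case: (g i (rho v) =P v) => _; last exact: cont_cst.
by apply: cont_coord; cont.
Qed.

Lemma sect_face i b : (i < n.+2)%N -> supp (sect_coord i b) \in faces M.
Proof.
move=> iN; rewrite supp_sect //; apply/(chain_faces hg).
by exists i; split => //; exists (supp (coord b)) => //; exact: coord_face.
Qed.

Section Sections.
Variables (i : nat) (iN : (i < n.+2)%N).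

Definition sect_fun : B -> Y := power_map (fun b => @sect_face i b iN).

Lemma sect_point : sect_fun point = point.
Proof.
by apply: coordP => v; rewrite coord_power_map /sect_coord; case: ifP.
Qed.

Definition sect : pointed_map B Y :=
  PointedMap (power_map_continuous (aK := fun b => @sect_face i b iN)
    (@sect_continuous i)) sect_point.

Lemma coord_sect b v : coord (sect b) v = sect_coord i b v.
Proof. by []. Qed.

Lemma sect_piece b : piece i (sect b).
Proof.
exists (supp (coord b)); first exact: coord_face.
exact: supp_sect.
Qed.

Lemma sectK b : retr (sect b) = b.
Proof.
apply: coordP => w; rewrite (coord_retr w iN (sect_piece b)) coord_sect.
by rewrite /sect_coord (chain_retract hg) // eqxx.
Qed.

Lemma retrK y : piece i y -> sect (retr y) = y.
Proof.
move=> yi; apply: coordP => v; rewrite coord_sect /sect_coord.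
case: (g i (rho v) =P v) => [E|nE]; first by rewrite (coord_retr _ iN yi) E.
have [s sK ys] := yi; apply/esym/eqP; apply: contra_notT nE => yv.
have /imsetP[w _ ->] : v \in (g i @: s)%SET by rewrite -ys inE.
by rewrite (chain_retract hg).
Qed.

End Sections.

Lemma sect_glued i (iN : (i < n.+2)%N) (iN' : (i.+1 < n.+2)%N) b :
  supp (coord b) \in faces (Lam i) -> sect iN b = sect iN' b.
Proof.
move=> bL; apply: coordP => v; rewrite !coord_sect /sect_coord.
have [->|bv] := eqVneq (coord b (rho v)) point; first by rewrite !if_same.
rewrite (chain_glued hg iN') // inE; apply: facesS bL.
by rewrite finset.sub1set inE.
Qed.

Lemma piece_meet i j y : (i < j)%N -> (j < n.+2)%N -> piece i y -> piece j y ->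
  supp (coord (retr y)) \in faces (Lam j.-1).
Proof.
move=> ij jN [s sK ys] [s' s'K ys'].
rewrite [supp _](supp_retr jN s'K ys').
by apply: (chain_meet hg ij jN sK s'K); rewrite -ys -ys'.
Qed.

(** Combined with [piece_meet], this allows a descent from copy [j] to an earlier copy one step at a
    time. *)
Lemma piece_meet_prev j y : (0 < j < n.+2)%N -> piece j y ->
  supp (coord (retr y)) \in faces (Lam j.-1) -> piece j.-1 y.
Proof.
case: j => // j /= jN yj yL; have jN' := ltnW jN.
by rewrite -(retrK jN yj) -(sect_glued jN' jN yL); exact: sect_piece.
Qed.

End RetractionOntoCopy.

(** * Permutations of vertices and coordinatewise homotopies *)

Section Relabelling.
Variables (X : ptopologicalType) (V : finType) (K K' : scomplex V) (s : {perm V}).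
Hypothesis sK : forall t : {set V}, t \in faces K -> (s @: t)%SET \in faces K'.

Lemma supp_relabel (x : V -> X) : supp (fun v => x (s^-1%g v)) = (s @: supp x)%SET.
Proof.
by apply/setP => v; rewrite -[in RHS](permKV s v) (mem_imset _ _ (@perm_inj _ s)) !inE.
Qed.

Lemma relabel_face (b : polyhedral_power X K) :
  supp (fun v => coord b (s^-1%g v)) \in faces K'.
Proof. by rewrite supp_relabel sK // coord_face. Qed.

Definition relabel : polyhedral_power X K -> polyhedral_power X K' :=
  power_map relabel_face.

Lemma coord_relabel b v : coord (relabel b) v = coord b (s^-1%g v).
Proof. by []. Qed.

Lemma relabel_continuous : continuous relabel.
Proof. by apply: power_map_continuous => v; apply: cont_coord; cont. Qed.

Lemma relabel_point : relabel point = point.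
Proof. exact: coordP. Qed.

End Relabelling.

Section PowerHomotopy.
Variables (R : realType) (X : ptopologicalType) (h : X * R -> X).
Hypotheses (ch : continuous h) (h0 : forall x, h (x, 0) = x)
  (hp : forall t, h (point, t) = point).
Variables (V : finType) (K : scomplex V).

(** A homotopy that fixes the base point can only shrink supports. *)
Lemma power_homotopy_face (p : polyhedral_power X K * R) :
  supp (fun v => h (coord p.1 v, p.2)) \in faces K.
Proof.
apply: facesS (coord_face p.1); apply/fintype.subsetP => v; rewrite !inE.
by apply: contraNN => /eqP ->; rewrite hp.
Qed.

Definition power_homotopy : polyhedral_power X K * R -> polyhedral_power X K :=
  power_map power_homotopy_face.

Lemma coord_power_homotopy b t v :
  coord (power_homotopy (b, t)) v = h (coord b v, t).
Proof. by []. Qed.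

Lemma power_homotopy_continuous : continuous power_homotopy.
Proof.
apply: power_map_continuous => v; apply: (cont_comp ch); cont.
by apply: cont_coord; cont.
Qed.

Lemma power_homotopy0 b : power_homotopy (b, 0) = b.
Proof. by apply: coordP => v; rewrite coord_power_homotopy. Qed.

Lemma power_homotopy_point t : power_homotopy (point, t) = point.
Proof. by apply: coordP => v; rewrite coord_power_homotopy. Qed.

End PowerHomotopy.

Lemma fibre_at_clamp (R : realType) (A B : ptopologicalType) (f : pointed_map A B)
    (z : homotopy_fibre R f) (t : R) : fibre_at z (val (to_ui t)) = fibre_at z t.
Proof. by rewrite /fibre_at uivalK. Qed.

Lemma fibre_map_clamp (R : realType) (A B : ptopologicalType) (f : pointed_map A B)
    (T : topologicalType) (a : T -> A) (h : T * R -> B) (ch : continuous h)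
    (h0 : forall z, h (z, 0) = point) (h1 : forall z, h (z, 1) = f (a z)) z t :
  fibre_at (fibre_map ch h0 h1 z) t = h (z, val (to_ui t)).
Proof. by []. Qed.

(** * The homotopy fibre of the fold *)

Section FibreGluing.
Variables (R : realType) (X : ptopologicalType) (V : finType) (M : scomplex V).
Variables (m n : nat) (K1 L2 : scomplex 'I_m) (hL2 : subcomplex L2 K1).
Variable theta : nat -> {perm 'I_m}.
Hypothesis theta_iso : forall i, simplicial_iso (theta i) K1 K1.
Local Notation Lam i := (image_complex (theta i) L2).
Variables (rho : V -> 'I_m) (g : nat -> 'I_m -> V).
Hypothesis hg : chain_of_copies M K1 (fun i => Lam i) n.+2 rho g.
Hypothesis clpt : closed [set (point : X)].
Variables (u : X -> R) (h : X * R -> X).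
Hypotheses (cu : continuous u) (up : u point = 0) (u0 : forall x, 0 <= u x)
  (ch : continuous h) (h0 : forall x, h (x, 0) = x)
  (hp : forall t, h (point, t) = point)
  (h1 : forall x, u x <= 1 -> h (x, 1) = point).
Local Notation I := (unit_interval R).
Local Notation Y := (polyhedral_power X M).
Local Notation B := (polyhedral_power X K1).
Local Notation G := (homotopy_fibre R (polyhedral_incl X hL2)).
Local Notation r := (retr hg clpt).
Local Notation F := (homotopy_fibre R r).

(** Its homotopy fibre is the space of paths in [B] issuing from the base point. *)
Definition idB : pointed_map B B := PointedMap (@cont_id B) erefl.
Local Notation P := (homotopy_fibre R idB).

Lemma path_contraction_continuous :
  continuous (fun p : P * R * R => fibre_at p.1.1 ((1 - p.1.2) * p.2)).
Proof. by cont. Qed.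
Lemma path_contraction_0 (p : P * R) : fibre_at p.1 ((1 - p.2) * 0) = point.
Proof. by rewrite fibre_at_le0 // mulr0. Qed.
Lemma path_contraction_1 (p : P * R) :
  fibre_at p.1 ((1 - p.2) * 1) = idB (fibre_at p.1 (1 - p.2)).
Proof. by rewrite mulr1. Qed.

Definition path_contraction : P * R -> P :=
  fibre_map path_contraction_continuous path_contraction_0 path_contraction_1.

Lemma path_contraction_map_continuous : continuous path_contraction.
Proof. by apply: fibre_map_continuous; cont. Qed.

Lemma path_contraction_pt q t : fibre_pt (path_contraction (q, t)) = fibre_at q (1 - t).
Proof. by []. Qed.

Lemma path_contraction_at q t s : 0 <= s <= 1 ->
  fibre_at (path_contraction (q, t)) s = fibre_at q ((1 - t) * s).
Proof. by move=> s01; rewrite fibre_map_at. Qed.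

Lemma path_contraction0 p : path_contraction (p, 0) = p.
Proof.
apply: fibreP => [|t t01].
  by rewrite fibre_map_pt /= subr0 fibre_at_ge1.
by rewrite fibre_map_at //= subr0 mul1r.
Qed.

Lemma path_contraction1 p : path_contraction (p, 1) = point.
Proof.
apply: fibreP => [|t t01].
  by rewrite fibre_map_pt /= subrr fibre_at_le0.
by rewrite fibre_map_at //= subrr mul0r fibre_at_le0.
Qed.

Lemma path_contraction_point t : path_contraction (point, t) = point.
Proof. by apply: fibreP => [|s s01]; rewrite ?fibre_map_pt ?fibre_map_at. Qed.

Local Notation hB := (power_homotopy hp (K := K1)).
Local Notation hL := (power_homotopy hp (K := L2)).

Lemma cont_hB (T : topologicalType) (b : T -> B) (t : T -> R) :
  continuous b -> continuous t -> continuous (fun z => hB (b z, t z)).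
Proof.
move=> cb ct; apply: (cont_comp (f := fun z => (b z, t z))
  (@power_homotopy_continuous R X h ch hp _ K1)).
exact: cont_pair.
Qed.

Lemma path_homotopy_continuous :
  continuous (fun p : P * R * R => hB (fibre_at p.1.1 p.2, p.1.2)).
Proof. by apply: cont_hB; cont. Qed.
Lemma path_homotopy_0 (p : P * R) : hB (fibre_at p.1 0, p.2) = point.
Proof. by rewrite fibre_at_le0 // power_homotopy_point. Qed.
Lemma path_homotopy_1 (p : P * R) :
  hB (fibre_at p.1 1, p.2) = idB (hB (fibre_pt p.1, p.2)).
Proof. by rewrite fibre_at_ge1. Qed.

Definition path_homotopy : P * R -> P :=
  fibre_map path_homotopy_continuous path_homotopy_0 path_homotopy_1.

Lemma path_homotopy_map_continuous : continuous path_homotopy.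
Proof. by apply: fibre_map_continuous; apply: cont_hB; cont. Qed.

Lemma path_homotopy_pt q s : fibre_pt (path_homotopy (q, s)) = hB (fibre_pt q, s).
Proof. by []. Qed.

Lemma path_homotopy_at q s t :
  fibre_at (path_homotopy (q, s)) t = hB (fibre_at q t, s).
Proof. by rewrite fibre_map_clamp /= fibre_at_clamp. Qed.

Lemma path_homotopy0 q : path_homotopy (q, 0) = q.
Proof.
by apply: fibreP => [|t t01]; rewrite ?path_homotopy_pt ?path_homotopy_at power_homotopy0.
Qed.

Lemma path_homotopy_point s : path_homotopy (point, s) = point.
Proof.
by apply: fibreP => [|t t01]; rewrite ?path_homotopy_pt ?path_homotopy_at power_homotopy_point.
Qed.

(** One operation acts on the values of a path, the other on its parameter. *)
Lemma path_homotopy_contraction q t : path_homotopy (path_contraction (q, t), 1) =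
  path_contraction (path_homotopy (q, 1), t).
Proof.
apply: fibreP => [|s s01].
  by rewrite path_homotopy_pt !path_contraction_pt path_homotopy_at.
by rewrite path_homotopy_at !path_contraction_at // path_homotopy_at.
Qed.

Lemma fibre_homotopy_continuous :
  continuous (fun p : G * R * R => hB (fibre_at p.1.1 p.2, p.1.2)).
Proof. by apply: cont_hB; cont. Qed.
Lemma fibre_homotopy_0 (p : G * R) : hB (fibre_at p.1 0, p.2) = point.
Proof. by rewrite fibre_at_le0 // power_homotopy_point. Qed.
Lemma fibre_homotopy_1 (p : G * R) :
  hB (fibre_at p.1 1, p.2) = polyhedral_incl X hL2 (hL (fibre_pt p.1, p.2)).
Proof. by rewrite fibre_at_ge1 //; exact: coordP. Qed.

Definition fibre_homotopy : G * R -> G :=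
  fibre_map fibre_homotopy_continuous fibre_homotopy_0 fibre_homotopy_1.

Lemma fibre_homotopy_map_continuous : continuous fibre_homotopy.
Proof.
apply: fibre_map_continuous.
apply: (cont_comp (f := fun p : G * R => (fibre_pt p.1, p.2))
  (@power_homotopy_continuous R X h ch hp _ L2)).
by cont.
Qed.

Lemma fibre_homotopy_pt q s : fibre_pt (fibre_homotopy (q, s)) = hL (fibre_pt q, s).
Proof. by []. Qed.

Lemma fibre_homotopy_at q s t :
  fibre_at (fibre_homotopy (q, s)) t = hB (fibre_at q t, s).
Proof. by rewrite fibre_map_clamp /= fibre_at_clamp. Qed.

Lemma fibre_homotopy0 q : fibre_homotopy (q, 0) = q.
Proof.
by apply: fibreP => [|t t01]; rewrite ?fibre_homotopy_pt ?fibre_homotopy_at power_homotopy0.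
Qed.

Lemma fibre_homotopy_point s : fibre_homotopy (point, s) = point.
Proof.
by apply: fibreP => [|t t01]; rewrite ?fibre_homotopy_pt ?fibre_homotopy_at power_homotopy_point.
Qed.

Section Embedding.
Variable j : nat.

Lemma theta_face (t : {set 'I_m}) : t \in faces K1 -> (theta j @: t)%SET \in faces K1.
Proof. by rewrite theta_iso. Qed.
Lemma thetaV_face (t : {set 'I_m}) :
  t \in faces K1 -> ((theta j)^-1%g @: t)%SET \in faces K1.
Proof. by rewrite (simplicial_isoV (theta_iso j)). Qed.
Local Notation tw := (relabel (X := X) theta_face).
Local Notation twV := (relabel (X := X) thetaV_face).

Lemma cont_tw (T : topologicalType) (b : T -> B) :
  continuous b -> continuous (fun z => tw (b z)).
Proof. exact: cont_comp (@relabel_continuous _ _ _ _ _ _). Qed.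

Lemma cont_twV (T : topologicalType) (b : T -> B) :
  continuous b -> continuous (fun z => twV (b z)).
Proof. exact: cont_comp (@relabel_continuous _ _ _ _ _ _). Qed.

Lemma embed_continuous : continuous (fun p : G * R => tw (fibre_at p.1 p.2)).
Proof. by apply: cont_tw; cont. Qed.
Lemma embed_0 (q : G) : tw (fibre_at q 0) = point.
Proof. by rewrite fibre_at_le0 // relabel_point. Qed.
Lemma embed_1 (q : G) :
  tw (fibre_at q 1) = idB (tw (polyhedral_incl X hL2 (fibre_pt q))).
Proof. by rewrite fibre_at_ge1. Qed.

(** [theta j] is an automorphism of [K1], so it relabels whole paths in [B] and not only their end
    points. *)
Definition embed : G -> P := fibre_map embed_continuous embed_0 embed_1.

Lemma embed_map_continuous : continuous embed.
Proof. by apply: fibre_map_continuous; apply: cont_tw; cont. Qed.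

Lemma embed_pt q : fibre_pt (embed q) = tw (polyhedral_incl X hL2 (fibre_pt q)).
Proof. by []. Qed.

Lemma embed_at q t : fibre_at (embed q) t = tw (fibre_at q t).
Proof. by rewrite fibre_map_clamp /= fibre_at_clamp. Qed.

Lemma embed_point : embed point = point.
Proof.
apply: fibreP => [|t t01]; rewrite ?embed_pt ?embed_at ?relabel_point //.
exact: coordP.
Qed.

Lemma twK b : twV (tw b) = b.
Proof. by apply: coordP => v; rewrite !coord_relabel invgK permK. Qed.

Lemma twVK b : tw (twV b) = b.
Proof. by apply: coordP => v; rewrite !coord_relabel invgK permKV. Qed.

Lemma embed_inj : injective embed.
Proof.
move=> q q' E; apply: fibreP => [|t t01].
  apply: coordP => v.
  have /(congr1 twV) : tw (polyhedral_incl X hL2 (fibre_pt q)) =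
    tw (polyhedral_incl X hL2 (fibre_pt q')) by rewrite -!embed_pt E.
  by rewrite !twK => /(congr1 (fun b => coord b v)).
by rewrite -[LHS]twK -embed_at E embed_at twK.
Qed.

Lemma path_homotopy_embed q t : path_homotopy (embed q, t) = embed (fibre_homotopy (q, t)).
Proof.
apply: fibreP => [|s s01].
  by rewrite path_homotopy_pt !embed_pt fibre_homotopy_pt; exact: coordP.
by rewrite path_homotopy_at !embed_at fibre_homotopy_at; exact: coordP.
Qed.

(** The image of [embed], described by end points; [unembed] is the continuous inverse on it. *)
Definition embedded : set P := [set q | supp (coord (fibre_pt q)) \in faces (Lam j)].

Lemma embed_embedded q : embedded (embed q).
Proof.
rewrite /embedded /= embed_pt [supp _]supp_relabel.
by apply/imsetP; exists (supp (coord (fibre_pt q))); first exact: coord_face.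
Qed.

Lemma unembed_face (q : set_type embedded) :
  supp (fun v => coord (fibre_pt (val q)) ((theta j)^-1^-1%g v)) \in faces L2.
Proof.
rewrite supp_relabel; have /imsetP[t tL ->] := set_valP q.
by rewrite imset_permK.
Qed.

Lemma unembed_continuous :
  continuous (fun p : set_type embedded * R => twV (fibre_at (val p.1) p.2)).
Proof.
apply: cont_twV; apply: fibre_at_continuous; cont.
by apply: (cont_comp (@initial_continuous _ _ _)); cont.
Qed.

Lemma unembed_0 (q : set_type embedded) : twV (fibre_at (val q) 0) = point.
Proof. by rewrite fibre_at_le0 // relabel_point. Qed.
Lemma unembed_1 (q : set_type embedded) :
  twV (fibre_at (val q) 1) = polyhedral_incl X hL2 (power_map unembed_face q).
Proof. by rewrite fibre_at_ge1 //; exact: coordP. Qed.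

Definition unembed : set_type embedded -> G :=
  fibre_map unembed_continuous unembed_0 unembed_1.

Lemma unembed_map_continuous : continuous unembed.
Proof.
apply: fibre_map_continuous; apply: power_map_continuous => v.
apply: cont_coord; apply: cont_fibre_pt; exact: initial_continuous.
Qed.

Lemma unembedK q : embed (unembed q) = val q.
Proof.
apply: fibreP => [|t t01]; last by rewrite embed_at fibre_map_at // twVK.
apply: coordP => v; rewrite embed_pt coord_relabel.
rewrite -[LHS]/(coord (fibre_pt (val q)) ((theta j)^-1^-1%g ((theta j)^-1%g v))).
by rewrite invgK permKV.
Qed.

(** The product stands for a minimum over the faces and the sum for a maximum over the vertices off
    a face; continuity is then immediate. *)
Definition dist (b : B) : R :=
  \prod_(s in faces (Lam j)) \sum_(v | v \notin s) u (coord b v).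

Lemma dist_continuous : continuous dist.
Proof.
apply: continuous_big => [|s _]; first exact: mul_continuous.
apply: continuous_big => [|v _]; first exact: add_continuous.
by apply: (cont_comp cu); apply: cont_coord; cont.
Qed.

Lemma dist_embedded (q : P) : embedded q -> dist (fibre_pt q) = 0.
Proof.
move=> qE; rewrite /dist (bigD1 (supp (coord (fibre_pt q)))) //= big1 ?mul0r //.
by move=> v; rewrite inE negbK => /eqP ->.
Qed.

Lemma dist_le1 (b : B) : dist b <= 1 ->
  exists2 s : {set 'I_m}, s \in faces (Lam j) & forall v, v \notin s -> u (coord b v) <= 1.
Proof.
move=> d1.
have [/existsP[s /andP[sL sum1]]|] := boolP [exists s : {set 'I_m},
    (s \in faces (Lam j)) && (\sum_(v | v \notin s) u (coord b v) <= 1)].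
  exists s => // v vs; apply: le_trans sum1; rewrite (bigD1 v) //= lerDl.
  by apply: sumr_ge0 => w _; exact: u0.
rewrite negb_exists => /forallP no.
have gt1 (s : {set 'I_m}) : s \in faces (Lam j) ->
    1 < \sum_(v | v \notin s) u (coord b v).
  by move=> sL; have := no s; rewrite sL /= -ltNge.
(* All factors exceed 1, and the empty face provides at least one. *)
suff : 1 < dist b by rewrite ltNge d1.
rewrite /dist (bigD1 finset.set0) ?faces0 //=.
apply: lt_le_trans (gt1 _ (faces0 _)) _; rewrite ler_peMr //.
  by apply: sumr_ge0 => w _; exact: u0.
elim/big_rec: _ => [|s x /andP[sL _] x1]; first exact: lexx.
by apply: (le_trans x1); rewrite ler_peMl ?(le_trans ler01) // ltW // gt1.
Qed.

(** Off the face given by [dist_le1] every coordinate satisfies [u <= 1], so [h] sends it to the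
    base point at time 1. *)
Lemma homotopy_embedded (q : P) : dist (fibre_pt q) <= 1 ->
  embedded (path_homotopy (q, 1)).
Proof.
move=> /dist_le1[s sL su]; rewrite /embedded /= path_homotopy_pt.
apply: facesS sL; apply/fintype.subsetP => v; rewrite inE.
by apply: contraR => /su/h1 E; rewrite coord_power_homotopy E.
Qed.

Local Notation halo := [set q : P | dist (fibre_pt q) <= 1].

Definition retract_near (q : set_type halo) : G :=
  unembed (exist _ (path_homotopy (val q, 1)) (mem_set (homotopy_embedded (set_valP q)))).

Lemma retract_near_continuous : continuous retract_near.
Proof.
apply: (cont_comp unembed_map_continuous); apply: continuous_comp_initial.
apply: (cont_comp path_homotopy_map_continuous); cont.
exact: initial_continuous.
Qed.

(** Made total by an arbitrary value outside the halo. *)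
Definition retraction (q : P) : G :=
  if pselect (halo q) is left qn then retract_near (exist _ q (mem_set qn)) else point.

Lemma retraction_continuous : {within halo, continuous retraction}.
Proof.
apply/subspace_sigL_continuousP.
have -> : sigL halo retraction = retract_near; last exact: retract_near_continuous.
apply/funext => q; rewrite /sigL /= /retraction; case: pselect => [qn|].
  by congr retract_near; exact: val_inj.
by have := set_valP q.
Qed.

Lemma embed_retraction q : dist (fibre_pt q) <= 1 ->
  embed (retraction q) = path_homotopy (q, 1).
Proof.
by move=> qn; rewrite /retraction; case: pselect => // ?; rewrite unembedK.
Qed.

Lemma dist_embed q : dist (fibre_pt (embed q)) = 0.
Proof. exact/dist_embedded/embed_embedded. Qed.

Lemma retraction_embed q : retraction (embed q) = fibre_homotopy (q, 1).
Proof.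
apply: embed_inj; rewrite embed_retraction ?path_homotopy_embed //.
by rewrite dist_embed ler01.
Qed.

End Embedding.

Section Copies.
Variable k : nat.
(** With [inord] the copies are indexed by all natural numbers; it does not change [k] when
    [k <= n.+1]. *)
Let kN : ((inord k : 'I_n.+2) < n.+2)%N := ltn_ord _.
Local Notation sk := (sect X hg kN).

Lemma copy_1 (q : P) : fibre_at q 1 = r (sk (fibre_pt q)).
Proof. by rewrite sectK fibre_at_ge1. Qed.
Lemma copy_0 (q : P) : fibre_at q 0 = point.
Proof. by rewrite fibre_at_le0. Qed.
Lemma copy_at_continuous : continuous (fun p : P * R => fibre_at p.1 p.2).
Proof. by cont. Qed.

Definition copy : P -> F := fibre_map copy_at_continuous copy_0 copy_1.

Lemma copy_continuous : continuous copy.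
Proof. by apply: fibre_map_continuous; cont. Qed.

Lemma copy_pt q : fibre_pt (copy q) = sk (fibre_pt q).
Proof. by []. Qed.

Lemma copy_at q t : fibre_at (copy q) t = fibre_at q t.
Proof. by rewrite fibre_map_clamp /= fibre_at_clamp. Qed.

Lemma copy_point : copy point = point.
Proof.
by apply: fibreP => [|t t01]; rewrite ?copy_pt ?copy_at // fibre_pt_point pointed_fun_point.
Qed.

End Copies.

Lemma to_path_continuous : continuous (fun p : F * R => fibre_at p.1 p.2).
Proof. by cont. Qed.
Lemma to_path_0 (x : F) : fibre_at x 0 = point.
Proof. by rewrite fibre_at_le0. Qed.
Lemma to_path_1 (x : F) : fibre_at x 1 = idB (r (fibre_pt x)).
Proof. by rewrite fibre_at_ge1. Qed.

(** A common left inverse of all the copies, since each of the sections is inverted by [r]. *)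
Definition to_path : F -> P := fibre_map to_path_continuous to_path_0 to_path_1.

Lemma to_path_map_continuous : continuous to_path.
Proof. by apply: fibre_map_continuous; cont. Qed.

Lemma to_path_copy k q : to_path (copy k q) = q.
Proof.
apply: fibreP => [|t t01]; last by rewrite fibre_map_at //= copy_at.
by rewrite fibre_map_pt copy_pt sectK.
Qed.

Lemma copy_piece k q : (k <= n.+1)%N -> piece K1 g k (fibre_pt (copy k q)).
Proof.
move=> kn; suff -> : @piece X V M m K1 g k = piece K1 g (inord k : 'I_n.+2).
  exact: sect_piece.
by rewrite inordK.
Qed.

Lemma copy_to_path k x : (k <= n.+1)%N -> piece K1 g k (fibre_pt x) ->
  copy k (to_path x) = x.
Proof.
move=> kn xk; apply: fibreP => [|t t01]; last by rewrite copy_at fibre_map_at.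
by rewrite copy_pt fibre_map_pt retrK // inordK.
Qed.

Lemma copy_surj x : exists2 k, (k <= n.+1)%N & exists p, x = copy k p.
Proof.
have [k xk] := piece_cover hg (fibre_pt x).
have kn : (k <= n.+1)%N by rewrite -ltnS.
by exists k => //; exists (to_path x); rewrite copy_to_path.
Qed.

Lemma copy_embed j q : (j <= n)%N -> copy j (embed j q) = copy j.+1 (embed j q).
Proof.
move=> jn; apply: fibreP => [|t t01]; last by rewrite !copy_at.
rewrite !copy_pt; apply: coordP => v; rewrite !coord_sect.
have jN : (j < n.+2)%N by rewrite ltnW // ltnS ltnS.
have jN' : (j.+1 < n.+2)%N by [].
have := congr1 (fun b => coord b v) (sect_glued hg jN jN' (embed_embedded j q)).
by rewrite /= !coord_sect !inordK.
Qed.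

(** [F * I] is a finite union of closed pieces, on which the map is [f k] after [to_path]. Values on
    the pieces [i < j] are compared through piece [j.-1], which contains their intersection. *)
Lemma copies_glue (T : topologicalType) (f : nat -> P * I -> T) :
  (forall k, (k <= n.+1)%N -> continuous (f k)) ->
  (forall j q s, (j <= n)%N -> f j (embed j q, s) = f j.+1 (embed j q, s)) ->
  exists F' : F * I -> T, continuous F' /\
    forall k p s, (k <= n.+1)%N -> F' (copy k p, s) = f k (p, s).
Proof.
move=> cf fe.
have fE j q s : (j <= n)%N -> embedded j q -> f j (q, s) = f j.+1 (q, s).
  move=> jn qE.
  by have := fe j (unembed (exist _ q (mem_set qE))) s jn; rewrite unembedK.
have indep j i x s : (i < j)%N -> (j <= n.+1)%N -> piece K1 g i (fibre_pt x) ->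
    piece K1 g j (fibre_pt x) -> f i (to_path x, s) = f j (to_path x, s).
  elim: j i => // j IH i; rewrite ltnS => ij jn xi xj.
  have xL : embedded j (to_path x) by apply: (piece_meet hg clpt (j := j.+1) (i := i)).
  have xj' : piece K1 g j (fibre_pt x).
    by apply: (piece_meet_prev (clpt := clpt) (hg := hg) (j := j.+1)).
  rewrite -fE //; move: ij; rewrite leq_eqVlt => /orP[/eqP -> //|ij].
  by apply: IH => //; exact: ltnW.
have indep' i j x s : (i <= n.+1)%N -> (j <= n.+1)%N ->
    piece K1 g i (fibre_pt x) -> piece K1 g j (fibre_pt x) ->
    f i (to_path x, s) = f j (to_path x, s).
  move=> iN jN xi xj; have [ij|ji|-> //] := ltngtP i j; first exact: indep.
  exact/esym/indep.
pose F' (p : F * I) := if [pick k : 'I_n.+2 | `[< piece K1 g k (fibre_pt p.1) >]]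
  is Some k then f k (to_path p.1, p.2) else f 0%N (to_path p.1, p.2).
have F'E k x s : (k <= n.+1)%N -> piece K1 g k (fibre_pt x) ->
    F' (x, s) = f k (to_path x, s).
  move=> kn xk; rewrite /F' /=; case: pickP => [k' /asboolP xk'|no].
    by apply: indep' => //; rewrite -ltnS.
  by have := no (Ordinal (kn : (k < n.+2)%N)); rewrite asboolT.
exists F'; split; last first.
  by move=> k p s kn; rewrite (F'E k) ?to_path_copy //; exact: copy_piece.
apply: (@cont_finite_cover _ _ _
    (fun k : 'I_n.+2 => [set p : F * I | piece K1 g k (fibre_pt p.1)])).
- move=> k; have cp : continuous (fun p : F * I => fibre_pt p.1) by cont.
  exact: (continuous_closedP _).1 cp _ (piece_closed hg clpt (ltn_ord k)).
- by move=> p; exact: piece_cover hg (fibre_pt p.1).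
- move=> k; have kn : (k <= n.+1)%N by rewrite -ltnS.
  apply: (@eq_within _ _ _ (fun p => f k (to_path p.1, p.2))).
    by move=> [x s] xk; rewrite (F'E k).
  apply: within_continuous; apply: (cont_comp (cf k kn)); cont.
  by apply: (cont_comp to_path_map_continuous); cont.
Qed.

Theorem fibre_of_retraction :
  homotopy_equivalent R F (pwedge (fun _ : 'I_n.+1 => suspension R G)).
Proof.
apply: (@glued_contractibles R P G F n path_contraction path_homotopy fibre_homotopy
  path_contraction_map_continuous path_contraction0 path_contraction1
  path_contraction_point path_homotopy_map_continuous path_homotopy0 _
  path_homotopy_contraction fibre_homotopy_map_continuous fibre_homotopy0 _
  (fun j q => dist j (fibre_pt q)) embed retraction _ _ _ _ _ _ _ _ copy).
- by move=> t _; exact: path_homotopy_point.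
- by move=> t _; exact: fibre_homotopy_point.
- move=> j _; apply: (cont_comp (g := dist j) (f := fun q : P => fibre_pt q)).
    exact: dist_continuous.
  exact: fibre_pt_continuous.
- by move=> j _; exact: embed_map_continuous.
- by move=> j _; exact: embed_point.
- by move=> j q _; exact: dist_embed.
- by move=> j q t _ _; exact: path_homotopy_embed.
- by move=> j _; exact: retraction_continuous.
- by move=> j q _; exact: embed_retraction.
- by move=> j q _; exact: retraction_embed.
- by move=> k _; exact: copy_continuous.
- by move=> k _; exact: copy_point.
- by move=> j q; exact: copy_embed.
- exact: copy_surj.
- exact: copies_glue.
Qed.

End FibreGluing.

(** * Loops on the polyhedral product of the glued complex *)

Theorem theorem4p9 (R : realType) (n m : nat) (hn : (2 <= n)%N)
  (K : nat -> scomplex 'I_m) (phi : nat -> nat -> {perm 'I_m})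
  (hphi : forall i j : nat, (1 <= i)%N -> (i < j)%N -> (j <= n)%N ->
    simplicial_iso (phi i j) (K i) (K j))
  (L1 L2 : scomplex 'I_m)
  (hL1 : subcomplex L1 (K 1%N)) (hL2 : subcomplex L2 (K 1%N))
  (psi : {perm 'I_m}) (hpsi : simplicial_iso psi (K 1%N) (K 1%N))
  (hpsi12 : simplicial_iso psi L1 L2) (hpsi21 : simplicial_iso psi L2 L1)
  (hglue : gluing_condition K phi psi L2 n)
  (X : ptopologicalType) (hX : pointed_cw_complex R X)
  (hXc : path_connected R X) :
  let M := stage_complex (iterated_gluing K phi psi L2 n) in
  let G : ptopologicalType := homotopy_fibre R (polyhedral_incl X hL2) in
  (* n.-2.+1 = n - 1 as n >= 2 *)
  exists F : ptopologicalType,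
    homotopy_equivalent R F (pwedge (fun _ : 'I_n.-2.+1 => suspension R G)) /\
    homotopy_equivalent R (loop_space R (polyhedral_power X M))
      (loop_space R (polyhedral_power X (K 1%N)) * loop_space R F)%type.
Proof.
(* From here on [n] is the original [n - 2]: there are [n.+2] copies and [n.+1] overlaps, one for
   each summand of the wedge. *)
case: n hn hphi hglue => [|[|n]] // _ hphi hglue M G.
have clpt : closed [set (point : X)].
  by case: hX => hausX _; exact/accessible_closed_set1/hausdorff_accessible.
have [u [h [cu up u0 ch [h0 hp h1]]]] := cw_well_pointed hX.
have [rho [g [hg _]]] := iterated_gluing_chain hphi hpsi hglue (ltnSn n.+1).
exists (homotopy_fibre R (retr hg clpt)); split.
  exact: (@fibre_of_retraction R X _ _ m n _ L2 hL2 (twist psi)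
    (twist_iso hpsi) rho g hg clpt u h).
(* The section of the fold is the inclusion of copy 0. *)
by apply: (@loop_space_splits _ _ _ _ (sect X hg (ltn0Sn n.+1))) => b; exact: sectK.
Qed.
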